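(* For every $n\ge0$, $$|\mathsf{GNC}_{n+2}(uu,h)|=\sum_{i=0}^n\binom{n}{i}2^{i+2}C_{i+1},\qquad |\mathsf{GNC}_{n}(dd,h)|=\sum_{j=0}^n(-1)^j\binom{2n-j}{j}3^j4^{n-j}C_{n-j},$$ where $C_k=\frac{1}{k+1}\binom{2k}{k}$.
   Context: A non-crossing tree on $n+1$ points: place $n+1$ points $p_0,\dots,p_n$ on a circle in counterclockwise order and draw a tree on them with straight edges inside the circle, no two crossing. A (rooted) GNC-tree with $n+1$ vertices is such a tree with a labelling of the points by positive integers, weakly increasing along $p_0,\dots,p_n$, $p_0$ labelled 1, label set $\{1,\dots,m\}$ for some $m$; rooted at $p_0$. $\mathsf{GNC}_n$ is the set of these. Orient each edge from parent (closer to root) to child; it is an ascent ($u$) if parent label $<$ child label, a level ($h$) if equal, a descent ($d$) if larger. Each root-to-vertex path gives a word over $\{u,h,d\}$; a tree contains $\sigma$ if some such word contains $\sigma$ as a contiguous factor, and avoids $\sigma$ otherwise. $\mathsf{GNC}_n(P)$ is the set of trees in $\mathsf{GNC}_n$ avoiding all words in $P$. *)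

(* Defs.v *)
From HB Require Import structures.
From mathcomp Require Import all_boot all_order all_algebra.

Set Implicit Arguments.
Unset Strict Implicit.
Unset Printing Implicit Defensive.

Import Order.TTheory GRing.Theory Num.Theory.

Variant letter := Ascent | Level | Descent.

Definition letter_code (a : letter) : option bool :=
  match a with Ascent => Some true | Level => None | Descent => Some false end.

Definition letter_decode (c : option bool) : letter :=
  match c with Some true => Ascent | None => Level | Some false => Descent end.

Lemma letter_codeK : cancel letter_code letter_decode.
Proof. by case. Qed.

HB.instance Definition _ := Equality.copy letter (can_type letter_codeK).

Section NonCrossingTrees.

Variable n : nat.

(* The points p_0, ..., p_n, in counterclockwise order on the circle. *)
Notation point := 'I_n.+1.

(* A graph on the points is the set of its edges, each edge being the set of
   its two endpoints. *)
Notation graph := {set {set point}}.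

Definition simple_graph (E : graph) : bool := [forall e in E, #|e| == 2].

Definition adj (E : graph) : rel point :=
  fun x y => (x != y) && ([set x; y] \in E).

Definition connected (E : graph) : bool :=
  [forall x, forall y, connect (adj E) x y].

(* A cycle visits pairwise distinct points, hence has length at most n + 1;
   the bound makes the quantification finite. *)
Definition acyclic (E : graph) : bool :=
  [forall c : {bseq n.+1 of point},
     ~~ [&& 2 < size c, uniq c & cycle (adj E) c]].

Definition tree (E : graph) : bool :=
  [&& simple_graph E, connected E & acyclic E].

(* Two chords of a circle meet inside it exactly when their endpoints
   interleave. *)
Definition noncrossing (E : graph) : bool :=
  [forall a : point, forall b : point, forall c : point, forall d : point,
     [&& a < b, b < c & c < d] ==>
     ~~ (([set a; c] \in E) && ([set b; d] \in E))].

(* Since the label set is {1, ..., m} and there are n + 1 points, m and all the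
   labels are at most n + 1, so that they can be taken in 'I_n.+2. *)
Notation labelling := {ffun point -> 'I_n.+2}.

Definition GNC_labelling (l : labelling) : bool :=
  [&& l ord0 == 1 :> nat,
      [forall i : point, forall j : point, (i <= j) ==> (l i <= l j)]
    & [exists m : 'I_n.+2, forall k : 'I_n.+2,
         (k \in codom l) == (0 < k <= m)]].

Definition step (l : labelling) (x y : point) : letter :=
  if l x < l y then Ascent else if l x == l y then Level else Descent.

(* The path from the root p_0 to a vertex is the simple path x_0 = p_0, x_1,
   ..., x_k, represented by [:: x_1; ...; x_k]; each x_i is the parent of
   x_(i+1). *)
Definition root_path (E : graph) (p : seq point) : bool :=
  path (adj E) ord0 p && uniq (ord0 :: p).

Definition word (l : labelling) (p : seq point) : seq letter :=
  pairmap (step l) ord0 p.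

Definition contains (t : graph * labelling) (s : seq letter) : bool :=
  [exists p : {bseq n of point}, root_path t.1 p && infix s (word t.2 p)].

Definition GNC : {set graph * labelling} :=
  [set t | [&& tree t.1, noncrossing t.1 & GNC_labelling t.2]].

Definition GNC_avoid (P : seq (seq letter)) : {set graph * labelling} :=
  [set t in GNC | all (fun s => ~~ contains t s) P].

Lemma acyclicP (E : graph) :
  reflect (forall c : seq point, 2 < size c -> uniq c -> ~~ cycle (adj E) c)
          (acyclic E).
Proof.
apply: (iffP forallP) => [acE c c_gt2 c_uniq | acE c].
  have szc : size c <= n.+1.
    by have := max_card (mem c); rewrite (card_uniqP c_uniq) card_ord.
  by have /= := acE (Bseq szc); rewrite c_gt2 c_uniq.
by apply/negP => /and3P[c_gt2 c_uniq]; apply/negP/acE.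
Qed.

Lemma containsP (t : graph * labelling) (s : seq letter) :
  reflect (exists2 p : seq point, root_path t.1 p & infix s (word t.2 p))
          (contains t s).
Proof.
apply: (iffP existsP) => [[p /andP[tp sp]] | [p tp sp]]; first by exists p.
have szp : size p <= n.
  have /andP[_ p_uniq] := tp.
  by have := max_card (mem (ord0 :: p)); rewrite (card_uniqP p_uniq) card_ord.
by exists (Bseq szp); rewrite tp.
Qed.

End NonCrossingTrees.

Local Open Scope ring_scope.

Definition Catalan (k : nat) : rat := k.+1%:R^-1 * 'C(2 * k, k)%:R.

(* Main.v *)
(* A labelled tree avoiding the letter h is a non-crossing tree together with
   the set of "strict" gaps between consecutive points where the label
   increases, each edge spanning at least one strict gap; ascents and descents
   are then determined by the positions of the points alone.  Removing an edge
   {a, b} from a non-crossing tree on the points a, ..., b leaves trees on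
   a, ..., k and k+1, ..., b, and a non-crossing tree without an edge over c
   splits at c.  Let X count the trees avoiding uu rooted at their leftmost
   point, and Y those rooted at their rightmost point.  A tree of the first kind
   that is not a point contains the edge {a, b}, and one of the second kind
   splits at the neighbour of the root that is furthest from it, whence
     X = 1 - z + 2 z X Y   and   Y = 1 + (X - 1) Y.
   Reversing the order of the points exchanges uu and dd, so that Y also counts
   the trees avoiding dd rooted at their leftmost point.  Eliminating, V = X Y
   and Y satisfy V = 1 + (2 z / (1 - z)) V^2 and Y = t + 4 z t Y^2 with
   t = 1 / (1 + 3 z), and F = t + v F^2 is solved by the sum of the
   C_i v^i t^(i+1). *)

Require Import Defs.
From mathcomp Require Import all_boot all_order all_algebra.
From mathcomp Require Import zify ring.

Set Implicit Arguments.
Unset Strict Implicit.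
Unset Printing Implicit Defensive.

(* [zify] is prohibitively slow on boolean hypotheses that are not about
   natural numbers. *)
Ltac ord_lia :=
  repeat match goal with
  | H : forall _ : 'I__, _ |- _ => clear H
  | H : is_true ?P |- _ =>
    lazymatch P with
    | context [leq] => fail
    | context [nat_of_ord] => fail
    | _ => clear H end
  end; lia.

(** * Connectivity and acyclicity *)

Lemma connect_hom (T T' : finType) (e : rel T) (e' : rel T') (f : T -> T') :
    (forall u v, e u v -> connect e' (f u) (f v)) ->
  forall x y, connect e x y -> connect e' (f x) (f y).
Proof.
move=> h x y /connectP[p]; elim: p x => [|z p IH] x /=; first by move=> _ ->.
by move=> /andP[xz pz] yl; apply: connect_trans (h _ _ xz) (IH _ pz yl).
Qed.

(** Serves to catch the edge by which a path leaves a set of points, such as an interval. That [u]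
    is reachable from [x] is kept, so that the edge can be placed in a known component. *)
Lemma exit_edge (T : finType) (e : rel T) (P : pred T) x y :
    connect e x y -> P x -> ~~ P y ->
  exists u v, [/\ connect e x u, e u v, P u & ~~ P v].
Proof.
move=> /connectP[p]; elim: p x => [|z p IH] x /=.
  by move=> _ -> ->.
move=> /andP[xz pz] yl Px nPy; case: (boolP (P z)) => Pz.
  have [u [v [zu uv Pu Pv]]] := IH _ pz yl Pz nPy.
  by exists u, v; split=> //; apply: connect_trans (connect1 xz) zu.
by exists x, z; split=> //; apply: connect0.
Qed.

Lemma eq_set2 (T : finType) (x y a b : T) :
  ([set x; y] == [set a; b]) =
  (x == a) && (y == b) || (x == b) && (y == a).
Proof.
apply/eqP/idP => [eqxy|/orP[]/andP[/eqP-> /eqP->] //]; last by rewrite setUC.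
have h z : (z \in [set x; y]) = (z \in [set a; b]) by rewrite eqxy.
have := h x; have := h y; have := h a; have := h b; rewrite !inE !eqxx ?orbT /=.
rewrite !(eq_sym a) !(eq_sym b).
by do 4![case: eqP => ? //=]; subst.
Qed.

Section Graphs.

Variable n : nat.
Notation point := 'I_n.+1.
Notation graph := {set {set point}}.
Implicit Types (E F : graph) (a b c k r u v x y z : point) (I J : {set point}).

Lemma adjC E x y : adj E x y = adj E y x.
Proof. by rewrite /adj eq_sym setUC. Qed.

Lemma connectC E x y : connect (adj E) x y = connect (adj E) y x.
Proof. by apply: sym_connect_sym => u v; apply: adjC. Qed.

Lemma adjD1 E e x y : adj (E :\ e) x y = ([set x; y] != e) && adj E x y.
Proof. by rewrite /adj !inE andbCA. Qed.

Lemma adjU E F x y : adj (E :|: F) x y = adj E x y || adj F x y.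
Proof. by rewrite /adj inE andb_orr. Qed.

Lemma adj_edge a b x y : a != b ->
  adj [set [set a; b]] x y = (x == a) && (y == b) || (x == b) && (y == a).
Proof.
move=> ab; rewrite /adj inE eq_set2; case: (x =P y) => [->|//] /=.
by apply/esym/negP => /orP[]/andP[/eqP ya /eqP yb]; rewrite -ya yb eqxx in ab.
Qed.

Lemma adj_sub E F x y : F \subset E -> adj F x y -> adj E x y.
Proof. by move=> /subsetP FE /andP[xy /FE]; rewrite /adj xy. Qed.

Lemma connect_subgraph E F x y :
  F \subset E -> connect (adj F) x y -> connect (adj E) x y.
Proof. by move=> FE; apply: (@connect_hom _ _ _ _ id) => u v /(adj_sub FE)/connect1. Qed.

(** A path from [x] to [y] that avoids this edge can be made simple; it then has at least two edges,
    and the edge closes it into a cycle. *)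
Lemma acyclic_bridge E x y : acyclic E -> adj E x y ->
  ~~ connect (adj (E :\ [set x; y])) x y.
Proof.
move=> /acyclicP acE xy; apply/negP => /connectP[p0 p0x].
case/shortenP: p0x => p px p_uniq _ yl.
have pE : path (adj E) x p.
  by apply: sub_path px => u v; apply: adj_sub; apply: subsetDl.
case: p px p_uniq yl pE => [|z [|t p]].
- by move=> _ _ yx; move: xy; rewrite yx /adj eqxx.
- by move=> /= /andP[xz _] _ yz; move: xz; rewrite yz adjD1 eqxx.
move=> _ u yl pE.
have /negP := acE [:: x, z, t & p] isT u; apply.
rewrite /cycle rcons_path pE /= adjC.
by move: yl => /= <-.
Qed.

(** Deleting the first edge of a cycle leaves the rest of the cycle joining its ends. With
    [acyclic_bridge], this turns acyclicity into a condition on single edges, which is easy to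
    transport between graphs. *)
Lemma bridge_acyclic E :
    (forall x y, adj E x y -> ~~ connect (adj (E :\ [set x; y])) x y) ->
  acyclic E.
Proof.
move=> brE; apply/acyclicP => -[|x [|y [|z p]]] // _ u_c; apply/negP.
rewrite /cycle rcons_path => /andP[/= /and3P[xy yz pz] lx].
have /negP := brE _ _ xy; apply; rewrite connectC.
have yp : path (adj (E :\ [set x; y])) y (z :: p).
  apply: (@sub_in_path _ (predC1 x) (adj E)); last by rewrite /= yz.
    move=> u v; rewrite !inE => ux vx uv; rewrite adjD1 uv andbT eq_set2.
    by rewrite (negPf ux) (negPf vx) andbF.
  apply/allP => v vp; apply: contraTneq u_c => vx /=.
  by rewrite -vx vp.
apply: (@connect_trans _ _ (last z p)).
  by apply/connectP; exists (z :: p).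
apply: connect1; rewrite adjD1 lx andbT eq_set2 eqxx andbT.
have lzp : last z p \in z :: p by apply: mem_last.
move: u_c; rewrite /= => /and3P[]; rewrite inE => xn yn _.
apply/norP; split; first by apply/negP => /andP[/eqP lx1 /eqP xy1]; rewrite xy1 eqxx in xn.
by apply: contraNneq yn => <-.
Qed.

Lemma acyclic_sub E F : F \subset E -> acyclic E -> acyclic F.
Proof.
move=> FE /acyclicP acE; apply/acyclicP => c c2 cu; apply/negP => cF.
have /negP := acE c c2 cu; apply; apply: sub_cycle cF => x y; exact: adj_sub.
Qed.

Lemma noncrossingP E :
  reflect (forall w x y z : point, w < x -> x < y -> y < z ->
             adj E w y -> adj E x z -> False)
          (noncrossing E).
Proof.
apply: (iffP forallP) => [nc w x y z wx xy yz /andP[_ wy] /andP[_ xz]|nc w].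
  have /forallP/(_ x)/forallP/(_ y)/forallP/(_ z) := nc w.
  by rewrite wx xy yz wy xz.
apply/forallP => x; apply/forallP => y; apply/forallP => z.
apply/implyP => /and3P[wx xy yz]; apply/negP => /andP[wy xz].
apply: (nc w x y z) => //; rewrite /adj ?wy ?xz andbT.
  by rewrite -val_eqE /=; lia.
by rewrite -val_eqE /=; lia.
Qed.

Lemma noncrossing_sub E F : F \subset E -> noncrossing E -> noncrossing F.
Proof.
move=> FE /noncrossingP ncE; apply/noncrossingP => w x y z wx xy yz wy xz.
by apply: (ncE w x y z) => //; apply: adj_sub FE _.
Qed.

(** All subtrees live on the same type of points, and [I] records which points they may use, so that
    cutting a tree needs no reindexing. *)
Definition graph_on I E := [forall e in E, (#|e| == 2) && (e \subset I)].

Lemma graph_on_adj I E x y : graph_on I E -> adj E x y -> (x \in I) && (y \in I).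
Proof.
move=> /forallP/(_ [set x; y])/implyP EI /andP[_ /EI/andP[_ /subsetP xyI]].
by rewrite !xyI // !inE eqxx ?orbT.
Qed.

Lemma graph_on_edge I E e : graph_on I E -> e \in E ->
  exists x y, e = [set x; y] /\ adj E x y.
Proof.
move=> /forallP/(_ e)/implyP EI eE; have /andP[/cards2P[x [y [xy e_xy]]] _] := EI eE.
by exists x, y; rewrite /adj -e_xy eE xy.
Qed.

Lemma graph_eq I J E F : graph_on I E -> graph_on J F ->
  adj E =2 adj F -> E = F.
Proof.
move=> EI FJ EF; apply/setP => e; apply/idP/idP => /[dup] eEF.
  move=> /(graph_on_edge EI)[x [y [-> ]]].
  by rewrite EF => /andP[].
move=> /(graph_on_edge FJ)[x [y [-> ]]].
by rewrite -EF => /andP[].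
Qed.

Lemma graph_onU I E F : graph_on I (E :|: F) = graph_on I E && graph_on I F.
Proof.
apply/forallP/andP => [EF|[/forallP EI /forallP FI] e].
  by split; apply/forallP => e; apply/implyP => eE;
     have /implyP := EF e; rewrite inE eE ?orbT; apply.
rewrite inE; apply/implyP => /orP[] eE; first by apply: (implyP (EI e)).
exact: (implyP (FI e)).
Qed.

Lemma graph_on1 I a b : a != b -> a \in I -> b \in I ->
  graph_on I [set [set a; b]].
Proof.
move=> ab aI bI; apply/forallP => e; apply/implyP; rewrite inE => /eqP->.
rewrite cards2 ab /=; apply/subsetP => x; rewrite !inE.
by case/orP=> /eqP->.
Qed.

Lemma graph_onS I J E : I \subset J -> graph_on I E -> graph_on J E.
Proof.
move=> IJ /forallP EI; apply/forallP => e; apply/implyP => /(implyP (EI e)).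
by case/andP=> -> /subset_trans ->.
Qed.

Definition restr E I : graph := [set e in E | e \subset I].

Lemma graph_on_restr I J E : graph_on J E -> graph_on I (restr E I).
Proof.
move=> /forallP EJ; apply/forallP => e; apply/implyP; rewrite inE => /andP[eE eI].
by have /implyP/(_ eE)/andP[-> _] := EJ e.
Qed.

Lemma adj_restr E I x y : adj (restr E I) x y = [&& adj E x y, x \in I & y \in I].
Proof.
by rewrite /adj !inE subUset !sub1set -!andbA.
Qed.

Definition tree_on I E :=
  [&& graph_on I E,
      [forall x in I, forall y in I, connect (adj E) x y] & acyclic E].

Lemma tree_onP I E :
  reflect [/\ graph_on I E, {in I &, forall x y, connect (adj E) x y}
            & acyclic E]
          (tree_on I E).
Proof.
apply: (iffP and3P) => -[EI cE acE]; split=> //.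
  move=> x y xI yI.
  by have /implyP/(_ xI)/forallP/(_ y)/implyP/(_ yI) := forallP cE x.
apply/forallP => x; apply/implyP => xI; apply/forallP => y; apply/implyP => yI.
exact: cE.
Qed.

(** [F] is seen as a quotient of [E]: an edge of [E] either is an edge of [F] between fixed points
    or is collapsed. Connectivity thus descends from [E] to [F], even after the same edge is deleted
    from both. *)
Definition retraction E F (f : point -> point) :=
  forall u v, adj E u v -> adj F u v /\ f u = u /\ f v = v \/ f u = f v.

Lemma connect_retract E F f e u v : retraction E F f ->
  connect (adj (E :\ e)) u v -> connect (adj (F :\ e)) (f u) (f v).
Proof.
move=> fr; apply: connect_hom => {}u {}v; rewrite adjD1 => /andP[uve /fr[[uv [-> ->]]|-> //]].
by apply: connect1; rewrite adjD1 uve.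
Qed.

Lemma connect_retract0 E F f u v : retraction E F f ->
  connect (adj E) u v -> connect (adj F) (f u) (f v).
Proof.
move=> fr; apply: connect_hom => {}u {}v /fr[[uv [-> ->]]|-> //].
exact: connect1.
Qed.

Lemma tree_retract I J E F f :
    F \subset E -> graph_on J F -> J \subset I -> {in J, f =1 id} ->
    retraction E F f ->
  tree_on I E -> tree_on J F.
Proof.
move=> FE FJ /subsetP JI fJ fr /tree_onP[EI cE acE]; apply/tree_onP; split=> //.
  move=> x y xJ yJ; rewrite -(fJ x) // -(fJ y) //.
  by apply: connect_retract0 fr _; apply: cE; apply: JI.
exact: acyclic_sub acE.
Qed.

(* In a tree, [x] is the parent of [y] for the root [r]: the edge {x, y} is a
   bridge, and [r] lies on the side of [x]. *)
Definition par r E x y := adj E x y && connect (adj (E :\ [set x; y])) r x.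

(** One direction pushes a path from [r] to [x] through the retraction; the other goes from [r] to
    [s] without the edge and then stays in [F]. This reduces parenthood in a composite tree to
    parenthood in a part rooted at the point where it is entered. *)
Lemma par_retract J E F f r s x y :
    F \subset E -> graph_on J F -> {in J, f =1 id} -> retraction E F f ->
    f r = s -> connect (adj (E :\ [set x; y])) r s -> adj F x y ->
  par r E x y = par s F x y.
Proof.
move=> FE FJ fJ fr frs rs xy; rewrite /par xy (adj_sub FE xy) /=.
have /andP[xJ _] := graph_on_adj FJ xy.
apply/idP/idP => [/(connect_retract fr)|sx]; first by rewrite frs fJ.
by apply: connect_trans rs _; apply: connect_subgraph sx; apply: setSD.
Qed.

Lemma bridge_retract J E F f x y :
    graph_on J F -> {in J, f =1 id} -> retraction E F f ->
    acyclic F -> adj F x y ->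
  ~~ connect (adj (E :\ [set x; y])) x y.
Proof.
move=> FJ fJ fr acF xy; apply: contra (acyclic_bridge acF xy) => /(connect_retract fr).
by have /andP[xJ yJ] := graph_on_adj FJ xy; rewrite !fJ.
Qed.

End Graphs.

(** * Splitting a non-crossing tree at an edge or at a vertex *)

Section Splitting.

Variable n : nat.
Notation point := 'I_n.+1.
Notation graph := {set {set point}}.
Implicit Types (E F : graph) (a b c k r u v x y z : point) (I J : {set point}).
Implicit Types (d : bool).

Definition itv a b : {set point} := [set x : point | a <= x <= b].

Definition nctree a b E := tree_on (itv a b) E && noncrossing E.

(* [d] selects the forbidden word: uu when it is true, dd when it is false. *)
Definition ltd d x y := if d then x < y else y < x.

(** No labels appear: they increase weakly along the points, so in a tree without levels an edge is
    an ascent exactly when the child comes after its parent. *)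
Definition avoid d r E :=
  [forall x, forall y, forall z,
     ~~ [&& par r E x y, par r E y z, ltd d x y & ltd d y z]].

Lemma avoidP d r E :
  reflect (forall x y z, par r E x y -> par r E y z ->
             ltd d x y -> ltd d y z -> False)
          (avoid d r E).
Proof.
apply: (iffP forallP) => [av x y z xy yz lxy lyz|av x].
  have /forallP/(_ y)/forallP/(_ z) := av x.
  by rewrite xy yz lxy lyz.
apply/forallP => y; apply/forallP => z; apply/negP => /and4P[]; exact: av.
Qed.

Lemma itv_adj a b E x y : graph_on (itv a b) E -> adj E x y ->
  [/\ a <= x, x <= b, a <= y & y <= b].
Proof.
by move=> EI /(graph_on_adj EI); rewrite !inE => /andP[/andP[-> ->] /andP[-> ->]].
Qed.

Lemma nctree_graph a b E : nctree a b E -> graph_on (itv a b) E.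
Proof. by case/andP=> /tree_onP[]. Qed.

Lemma nctree_acyclic a b E : nctree a b E -> acyclic E.
Proof. by case/andP=> /tree_onP[]. Qed.

Lemma nctree_connect a b E x y : nctree a b E -> a <= x <= b -> a <= y <= b ->
  connect (adj E) x y.
Proof. by case/andP=> /tree_onP[_ cE _] _ xab yab; apply: cE; rewrite inE. Qed.

Lemma nctree_retract a b a' b' E F f :
    F \subset E -> graph_on (itv a' b') F -> a <= a' -> b' <= b ->
    (forall x, a' <= x <= b' -> f x = x) -> retraction E F f ->
  nctree a b E -> nctree a' b' F.
Proof.
move=> FE FI aa bb fI fr /andP[tE nE]; apply/andP; split; last exact: noncrossing_sub nE.
apply: (tree_retract FE FI _ _ fr tE).
  by apply/subsetP => x; rewrite !inE; ord_lia.
by move=> x; rewrite inE => /fI.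
Qed.

Definition glue a b E1 E2 : graph := [set a; b] |: (E1 :|: E2).

(** * Two trees on adjacent intervals joined by an edge between the outer end points *)

Section EdgeGlue.

Variables (a b k k' : point) (E1 E2 : graph).
Hypotheses (ak : a <= k) (kk' : k' = k.+1 :> nat) (kb : k' <= b).
Hypotheses (gE1 : graph_on (itv a k) E1) (gE2 : graph_on (itv k' b) E2).

Let E := glue a b E1 E2.

Let ab : a != b. Proof. by rewrite -val_eqE /=; ord_lia. Qed.

Lemma adj_glue x y : adj E x y =
  (x == a) && (y == b) || (x == b) && (y == a) || (adj E1 x y || adj E2 x y).
Proof. by rewrite !adjU adj_edge. Qed.

Lemma adj_glueP x y : adj E x y ->
  [\/ x = a /\ y = b, x = b /\ y = a, adj E1 x y | adj E2 x y].
Proof.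
rewrite adj_glue => /orP[/orP[]/andP[/eqP-> /eqP->]|/orP[]];
  by [constructor 1|constructor 2|constructor 3|constructor 4].
Qed.

Lemma glue_sub1 : E1 \subset E.
Proof. by rewrite /E /glue setUCA subsetUl. Qed.

Lemma glue_sub2 : E2 \subset E.
Proof. by rewrite /E /glue setUA subsetUr. Qed.

Lemma glue_graph : graph_on (itv a b) E.
Proof.
rewrite !graph_onU graph_on1 ?inE //=; try ord_lia.
by apply/andP; split; [apply: graph_onS gE1|apply: graph_onS gE2];
  apply/subsetP => x; rewrite !inE; ord_lia.
Qed.

(** The right part is collapsed to [a], where the left part is entered; [glue_f2] collapses the left
    part to [b]. *)
Definition glue_f1 (v : point) := if v <= k then v else a.
Definition glue_f2 (v : point) := if v <= k then b else v.

Lemma glue_retract1 : retraction E E1 glue_f1.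
Proof.
rewrite /glue_f1 => u v /adj_glueP[[-> ->]|[-> ->]|uv|uv].
- by right; rewrite ak ifF //; ord_lia.
- by right; rewrite ak ifF //; ord_lia.
- by left; have [_ -> _ ->] := itv_adj gE1 uv.
- by right; have [? ? ? ?] := itv_adj gE2 uv; rewrite !ifF //; ord_lia.
Qed.

Lemma glue_retract2 : retraction E E2 glue_f2.
Proof.
rewrite /glue_f2 => u v /adj_glueP[[-> ->]|[-> ->]|uv|uv].
- by right; rewrite ak ifF //; ord_lia.
- by right; rewrite ak ifF //; ord_lia.
- by right; have [_ -> _ ->] := itv_adj gE1 uv.
- by left; have [? ? ? ?] := itv_adj gE2 uv; rewrite !ifF //; ord_lia.
Qed.

Lemma glue_f1_id : {in itv a k, glue_f1 =1 id}.
Proof. by move=> x; rewrite inE /glue_f1 => /andP[_ ->]. Qed.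

Lemma glue_f2_id : {in itv k' b, glue_f2 =1 id}.
Proof. by move=> x; rewrite inE /glue_f2 => ?; rewrite ifF //; ord_lia. Qed.

Lemma nctree_unglue : nctree a b E -> nctree a k E1 /\ nctree k' b E2.
Proof.
move=> nE; split.
  apply: (nctree_retract glue_sub1 gE1 _ _ _ glue_retract1 nE) => //; first by ord_lia.
  by move=> x xI; apply: glue_f1_id; rewrite inE.
apply: (nctree_retract glue_sub2 gE2 _ _ _ glue_retract2 nE) => //; first by ord_lia.
by move=> x xI; apply: glue_f2_id; rewrite inE.
Qed.

(** A path from [a] to [b] has to cross the gap after [k], and neither [E1] nor [E2] has an edge
    across it. *)
Lemma glue_bridge : ~~ connect (adj (E :\ [set a; b])) a b.
Proof.
apply/negP => cab.
have [|u [v [_]]] := @exit_edge _ _ (fun v : point => v <= k) _ _ cab ak.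
  by rewrite -ltnNge; ord_lia.
 rewrite adjD1 eq_set2 => /andP[uvab /adj_glueP[[ua vb]|[ub va]|uv|uv]] uk vk.
- by rewrite ua vb !eqxx in uvab.
- by rewrite ub va !eqxx orbT in uvab.
- by have [] := itv_adj gE1 uv; ord_lia.
- by have [] := itv_adj gE2 uv; ord_lia.
Qed.

Lemma nctree_glue : nctree a k E1 -> nctree k' b E2 -> nctree a b E.
Proof.
move=> nE1 nE2; apply/andP; split; last first.
  apply/noncrossingP => w x y z wx xy yz.
  have nc1 := noncrossingP _ (proj2 (andP nE1)).
  have nc2 := noncrossingP _ (proj2 (andP nE2)).
  move=> /adj_glueP[[wa yb]|[wa yb]|wy|wy] /adj_glueP[[xa zb]|[xa zb]|xz|xz];
    subst; try (by ord_lia).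
  all: try have [? ? ? ?] := itv_adj gE1 wy.
  all: try have [? ? ? ?] := itv_adj gE2 wy.
  all: try have [? ? ? ?] := itv_adj gE1 xz.
  all: try have [? ? ? ?] := itv_adj gE2 xz.
  all: try (by ord_lia).
  - exact: nc1 wx xy yz wy xz.
  - exact: nc2 wx xy yz wy xz.
have cab : connect (adj E) a b by apply: connect1; rewrite adj_glue !eqxx.
apply/tree_onP; split; first exact: glue_graph.
  suff ca x : x \in itv a b -> connect (adj E) x a.
    by move=> x y xI yI; apply: connect_trans (ca _ xI) _; rewrite connectC ca.
  rewrite inE => xI; case: (leqP x k) => xk.
    by apply: connect_subgraph glue_sub1 _; apply: nctree_connect nE1 _ _; ord_lia.
  rewrite connectC; apply: connect_trans cab _.
  by apply: connect_subgraph glue_sub2 _; apply: nctree_connect nE2 _ _; ord_lia.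
apply: bridge_acyclic => x y /adj_glueP[[-> ->]|[-> ->]|xy|xy].
- exact: glue_bridge.
- by rewrite connectC setUC glue_bridge.
- exact: bridge_retract gE1 glue_f1_id glue_retract1 (nctree_acyclic nE1) xy.
- exact: bridge_retract gE2 glue_f2_id glue_retract2 (nctree_acyclic nE2) xy.
Qed.

Lemma par_glue1 r x y : r = a \/ r = b -> adj E1 x y ->
  par r E x y = par a E1 x y.
Proof.
move=> rab xy.
apply: par_retract glue_sub1 gE1 glue_f1_id glue_retract1 _ _ (xy).
  by rewrite /glue_f1; case: rab => ->; rewrite ?ak // ifF //; ord_lia.
case: rab => ->; rewrite ?connect0 //.
have [? ? ? ?] := itv_adj gE1 xy.
apply: connect1; rewrite adjD1 adj_glue !eqxx orbT andbT eq_set2 -!val_eqE /=; ord_lia.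
Qed.

Lemma par_glue2 r x y : r = a \/ r = b -> adj E2 x y ->
  par r E x y = par b E2 x y.
Proof.
move=> rab xy.
apply: par_retract glue_sub2 gE2 glue_f2_id glue_retract2 _ _ (xy).
  by rewrite /glue_f2; case: rab => ->; rewrite ?ak // ifF //; ord_lia.
case: rab => ->; rewrite ?connect0 //.
have [? ? ? ?] := itv_adj gE2 xy.
apply: connect1; rewrite adjD1 adj_glue !eqxx andbT eq_set2 -!val_eqE /=; ord_lia.
Qed.

(** The edge {a, b} joins the least and the greatest point, so it is never one of two consecutive
    steps in the same direction: nothing lies beyond either end. Edges from different parts share no
    vertex. *)
Lemma avoid_glue d r : r = a \/ r = b ->
  avoid d r E = avoid d a E1 && avoid d b E2.
Proof.
move=> rab; apply/idP/andP => [/avoidP av|[/avoidP av1 /avoidP av2]].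
  split; apply/avoidP => x y z.
    move=> /[dup] /andP[xy _] + /[dup] /andP[yz _].
    by rewrite -!(par_glue1 rab) //; apply: av.
  move=> /[dup] /andP[xy _] + /[dup] /andP[yz _].
  by rewrite -!(par_glue2 rab) //; apply: av.
apply/avoidP => x y z /[dup] /andP[xy _] pxy /[dup] /andP[yz _] pyz.
have [axy bxy ayy byy] := itv_adj glue_graph xy.
have [_ _ ayz byz] := itv_adj glue_graph yz.
move: (adj_glueP xy) (adj_glueP yz) => {xy yz}.
case=> [[? ?]|[? ?]|xy|xy] [[? ?]|[? ?]|yz|yz]; subst;
  try (by rewrite /ltd; case: (d); ord_lia).
- by rewrite (par_glue1 rab) // in pxy; rewrite (par_glue1 rab) // in pyz; apply: av1 pxy pyz.
- by have [? ? ? ?] := itv_adj gE1 xy; have [? ? ? ?] := itv_adj gE2 yz; ord_lia.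
- by have [? ? ? ?] := itv_adj gE2 xy; have [? ? ? ?] := itv_adj gE1 yz; ord_lia.
- by rewrite (par_glue2 rab) // in pxy; rewrite (par_glue2 rab) // in pyz; apply: av2 pxy pyz.
Qed.

End EdgeGlue.

(** * Two trees on intervals sharing one end point *)

Section VertexGlue.

Variables (a b c : point) (E1 E2 : graph).
Hypotheses (ac : a <= c) (cb : c <= b).
Hypotheses (gE1 : graph_on (itv a c) E1) (gE2 : graph_on (itv c b) E2).

Let E := E1 :|: E2.

Lemma join_graph : graph_on (itv a b) E.
Proof.
rewrite !graph_onU.
by apply/andP; split; [apply: graph_onS gE1|apply: graph_onS gE2];
  apply/subsetP => x; rewrite !inE; ord_lia.
Qed.

Definition join_f1 (v : point) := if v <= c then v else c.
Definition join_f2 (v : point) := if v <= c then c else v.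

Lemma join_retract1 : retraction E E1 join_f1.
Proof.
rewrite /join_f1 => u v; rewrite adjU => /orP[] uv.
  by left; have [_ -> _ ->] := itv_adj gE1 uv.
have [? ? ? ?] := itv_adj gE2 uv; right.
by case: ifPn => ?; case: ifPn => ? //; apply/val_inj => /=; ord_lia.
Qed.

Lemma join_retract2 : retraction E E2 join_f2.
Proof.
rewrite /join_f2 => u v; rewrite adjU => /orP[] uv.
  by right; have [_ -> _ ->] := itv_adj gE1 uv.
have [? ? ? ?] := itv_adj gE2 uv; left; split=> //.
by split; case: ifPn => ? //; apply/val_inj => /=; ord_lia.
Qed.

Lemma join_f1_id : {in itv a c, join_f1 =1 id}.
Proof. by move=> x; rewrite inE /join_f1 => /andP[_ ->]. Qed.

Lemma join_f2_id : {in itv c b, join_f2 =1 id}.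
Proof.
move=> x; rewrite inE /join_f2 => ?.
by case: ifPn => ? //; apply/val_inj => /=; ord_lia.
Qed.

Lemma nctree_unjoin : nctree a b E -> nctree a c E1 /\ nctree c b E2.
Proof.
move=> nE; split.
  apply: (nctree_retract _ gE1 _ _ _ join_retract1 nE) => //; first exact: subsetUl.
  by move=> x xI; apply: join_f1_id; rewrite inE.
apply: (nctree_retract _ gE2 _ _ _ join_retract2 nE) => //; first exact: subsetUr.
by move=> x xI; apply: join_f2_id; rewrite inE.
Qed.

Lemma nctree_join : nctree a c E1 -> nctree c b E2 -> nctree a b E.
Proof.
move=> nE1 nE2; apply/andP; split; last first.
  apply/noncrossingP => w x y z wx xy yz.
  have nc1 := noncrossingP _ (proj2 (andP nE1)).
  have nc2 := noncrossingP _ (proj2 (andP nE2)).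
  rewrite !adjU => /orP[] wy /orP[] xz.
  - exact: nc1 wx xy yz wy xz.
  - by have [? ? ? ?] := itv_adj gE1 wy; have [? ? ? ?] := itv_adj gE2 xz; ord_lia.
  - by have [? ? ? ?] := itv_adj gE2 wy; have [? ? ? ?] := itv_adj gE1 xz; ord_lia.
  - exact: nc2 wx xy yz wy xz.
apply/tree_onP; split; first exact: join_graph.
  suff cc x : x \in itv a b -> connect (adj E) x c.
    by move=> x y xI yI; apply: connect_trans (cc _ xI) _; rewrite connectC cc.
  rewrite inE => xI; case: (leqP x c) => xc.
    by apply: connect_subgraph (subsetUl _ _) _; apply: nctree_connect nE1 _ _; ord_lia.
  by apply: connect_subgraph (subsetUr _ _) _; apply: nctree_connect nE2 _ _; ord_lia.
apply: bridge_acyclic => x y; rewrite adjU => /orP[] xy.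
- exact: bridge_retract gE1 join_f1_id join_retract1 (nctree_acyclic nE1) xy.
- exact: bridge_retract gE2 join_f2_id join_retract2 (nctree_acyclic nE2) xy.
Qed.

Hypotheses (nE1 : nctree a c E1) (nE2 : nctree c b E2).

Lemma join_disjoint x y : adj E1 x y -> adj E2 x y -> False.
Proof.
move=> xy1 xy2; have [? ? ? ?] := itv_adj gE1 xy1; have [? ? ? ?] := itv_adj gE2 xy2.
have xy : x = y by apply: val_inj => /=; ord_lia.
by move: xy1; rewrite xy /adj eqxx.
Qed.

Lemma join_subD1 x y : adj E1 x y -> E2 \subset E :\ [set x; y].
Proof.
move=> xy; rewrite subsetD1 subsetUr; apply/negP => xy2.
by apply: (join_disjoint xy); case/andP: xy => xy _; apply/andP.
Qed.

Lemma join_subD2 x y : adj E2 x y -> E1 \subset E :\ [set x; y].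
Proof.
move=> xy; rewrite subsetD1 subsetUl; apply/negP => xy1.
by apply: (join_disjoint _ xy); case/andP: xy => xy _; apply/andP.
Qed.

(** Seen from [a], the first tree keeps its root and the second is entered at [c]; seen from [b], it
    is the reverse. *)
Lemma par_join_a1 x y : adj E1 x y -> par a E x y = par a E1 x y.
Proof.
move=> xy; apply: par_retract (subsetUl _ _) gE1 join_f1_id join_retract1 _ _ (xy).
  by rewrite /join_f1 ac.
exact: connect0.
Qed.

Lemma par_join_a2 x y : adj E2 x y -> par a E x y = par c E2 x y.
Proof.
move=> xy; apply: par_retract (subsetUr _ _) gE2 join_f2_id join_retract2 _ _ (xy).
  by rewrite /join_f2 ac.
by apply: connect_subgraph (join_subD2 xy) _; apply: nctree_connect nE1 _ _; ord_lia.
Qed.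

Lemma par_join_b1 x y : adj E1 x y -> par b E x y = par c E1 x y.
Proof.
move=> xy; apply: par_retract (subsetUl _ _) gE1 join_f1_id join_retract1 _ _ (xy).
  by rewrite /join_f1; case: ifPn => ? //; apply/val_inj => /=; ord_lia.
by apply: connect_subgraph (join_subD1 xy) _; apply: nctree_connect nE2 _ _; ord_lia.
Qed.

Lemma par_join_b2 x y : adj E2 x y -> par b E x y = par b E2 x y.
Proof.
move=> xy; apply: par_retract (subsetUr _ _) gE2 join_f2_id join_retract2 _ _ (xy).
  by rewrite /join_f2; case: ifPn => ? //; apply/val_inj => /=; ord_lia.
exact: connect0.
Qed.

Lemma par_to_root r F x : acyclic F -> ~~ par r F x r.
Proof.
move=> acF; apply/negP => /andP[xr]; rewrite connectC => rx.
by have /negP := acyclic_bridge acF xr; apply.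
Qed.

(** Two consecutive steps can pass from one tree to the other only at [c]. Seen from [b], the first
    tree is rooted at [c], so [c] has no parent in it; and no edge of the second tree ascends to
    [c], its least point. *)
Lemma avoid_join_up : avoid true b E = avoid true c E1 && avoid true b E2.
Proof.
apply/idP/andP => [/avoidP av|[/avoidP av1 /avoidP av2]].
  split; apply/avoidP => x y z.
    move=> /[dup] /andP[xy _] + /[dup] /andP[yz _].
    by rewrite -!par_join_b1 //; apply: av.
  move=> /[dup] /andP[xy _] + /[dup] /andP[yz _].
  by rewrite -!par_join_b2 //; apply: av.
apply/avoidP => x y z /[dup] /andP[+ _] pxy /[dup] /andP[+ _] pyz.
rewrite /ltd !adjU => /orP[] xy /orP[] yz lxy lyz.
- by rewrite par_join_b1 // in pxy; rewrite par_join_b1 // in pyz; apply: av1 pxy pyz _ _.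
- have [? ? ? ?] := itv_adj gE1 xy; have [? ? ? ?] := itv_adj gE2 yz.
  have yc : y = c by apply: val_inj => /=; ord_lia.
  move: pxy; rewrite par_join_b1 // yc.
  by apply/negP/par_to_root/(nctree_acyclic nE1).
- by have [? ? ? ?] := itv_adj gE2 xy; have [? ? ? ?] := itv_adj gE1 yz; ord_lia.
- by rewrite par_join_b2 // in pxy; rewrite par_join_b2 // in pyz; apply: av2 pxy pyz _ _.
Qed.

Lemma avoid_join_down : avoid false a E = avoid false a E1 && avoid false c E2.
Proof.
apply/idP/andP => [/avoidP av|[/avoidP av1 /avoidP av2]].
  split; apply/avoidP => x y z.
    move=> /[dup] /andP[xy _] + /[dup] /andP[yz _].
    by rewrite -!par_join_a1 //; apply: av.
  move=> /[dup] /andP[xy _] + /[dup] /andP[yz _].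
  by rewrite -!par_join_a2 //; apply: av.
apply/avoidP => x y z /[dup] /andP[+ _] pxy /[dup] /andP[+ _] pyz.
rewrite /ltd !adjU => /orP[] xy /orP[] yz lxy lyz.
- by rewrite par_join_a1 // in pxy; rewrite par_join_a1 // in pyz; apply: av1 pxy pyz _ _.
- by have [? ? ? ?] := itv_adj gE1 xy; have [? ? ? ?] := itv_adj gE2 yz; ord_lia.
- have [? ? ? ?] := itv_adj gE2 xy; have [? ? ? ?] := itv_adj gE1 yz.
  have yc : y = c by apply: val_inj => /=; ord_lia.
  move: pxy; rewrite par_join_a2 // yc.
  by apply/negP/par_to_root/(nctree_acyclic nE2).
- by rewrite par_join_a2 // in pxy; rewrite par_join_a2 // in pyz; apply: av2 pxy pyz _ _.
Qed.

End VertexGlue.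

End Splitting.

(** * Existence and uniqueness of the cuts *)

Section Decomposition.

Variable n : nat.
Notation point := 'I_n.+1.
Notation graph := {set {set point}}.
Implicit Types (E F : graph) (a b c k r u v x y z : point) (I J : {set point}).
Implicit Types (d : bool).

(* The gap between [k] and [k.+1] is crossed by no edge but {a, b}. *)
Definition splits a b k E :=
  (a <= k < b) &&
  [forall x, forall y, adj (E :\ [set a; b]) x y ==> ~~ (x <= k < y)].

Lemma splitsP a b k E :
  reflect (a <= k < b /\
             forall x y, adj E x y -> [set x; y] != [set a; b] -> x <= k < y -> False)
          (splits a b k E).
Proof.
apply: (iffP andP) => -[akb sp]; split=> //.
  move=> x y xy ne xky.
  have /forallP/(_ y)/implyP := forallP sp x.
  by rewrite adjD1 ne xy xky => /(_ isT).
apply/forallP => x; apply/forallP => y; apply/implyP; rewrite adjD1 => /andP[ne xy].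
by apply/negP => xky; apply: (sp x y).
Qed.

(** For two such gaps [j < k], the points after [j] up to [k] contain neither [a] nor [b], and no
    edge leaves them, against connectedness. *)
Lemma split_uniq a b j k E : nctree a b E -> splits a b j E -> splits a b k E ->
  j = k.
Proof.
wlog jk : j k / j < k.
  move=> th nE sj sk; case: (ltngtP j k) => [jk|kj|]; last exact: val_inj.
    exact: th.
  by apply/esym; apply: th.
move=> nE /splitsP[ajb sj] /splitsP[akb sk].
have ck : connect (adj E) k a by apply: nctree_connect nE _ _; ord_lia.
have [||u [v [_ uv /andP[ju uk]]]] :=
  @exit_edge _ _ (fun v : point => j < v <= k) _ _ ck _ _.
- by rewrite jk leqnn.
- by move=> /=; ord_lia.
have ne : [set u; v] != [set a; b] by rewrite eq_set2 -!val_eqE /=; ord_lia.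
rewrite /= negb_and -leqNgt -ltnNge => /orP[vj|kv].
  case: (sj v u); [by rewrite adjC| by rewrite setUC| by ord_lia].
by case: (sk u v) => //; ord_lia.
Qed.

(** Without {a, b} the tree falls into the component of [a] and that of [b]. As edges do not cross,
    the first is an initial interval, and [k] is its last point. *)
Lemma split_exists a b E : nctree a b E -> adj E a b -> a < b ->
  exists k, splits a b k E.
Proof.
move=> nE ab ltab; set E' := E :\ [set a; b].
have /noncrossingP nc := proj2 (andP nE).
have bA : ~~ connect (adj E') a b := acyclic_bridge (nctree_acyclic nE) ab.
have E'E u v : adj E' u v -> adj E u v by apply: adj_sub; apply: subsetDl.
(* A path of [E] from [x] to [a] stays in [E'] until it first uses {a, b}; as [a] is out of reach in
   [E'], it is then at [b]. *)
have AorB x : a <= x <= b -> ~~ connect (adj E') a x -> connect (adj E') x b.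
  move=> xab; have xa : connect (adj E) x a by apply: nctree_connect nE _ _; ord_lia.
  move: xa => /connectP[p]; elim: p x {xab} => [|y p IH] x /= => [_ <-|].
    by rewrite connect0.
  move=> /andP[xy py] la nax.
  case: (boolP ([set x; y] == [set a; b])) => [|ne].
    rewrite eq_set2 => /orP[]/andP[/eqP xa /eqP yb]; last by rewrite xa connect0.
    by rewrite xa connect0 in nax.
  have xy' : adj E' x y by rewrite adjD1 ne.
  apply: connect_trans (connect1 xy') _; apply: IH => //.
  by apply: contra nax => /connect_trans; apply; apply: connect1; rewrite adjC.
have aA : connect (adj E') a a by apply: connect0.
case: (arg_maxnP (fun v : point => v : nat) aA) => k kA kmax.
have inab x : connect (adj E') a x -> a <= x <= b.
  move=> ax; apply/negPn/negP => nx.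
  have aab : a <= a <= b by ord_lia.
  have [//|u [v [_ /E'E uv uab]]] :=
    @exit_edge _ _ (fun v : point => a <= v <= b) _ _ ax aab.
  by have [_ _ -> ->] := itv_adj (nctree_graph nE) uv.
have kab := inab _ kA.
have kb : k < b.
  rewrite ltn_neqAle; case/andP: kab => _ ->; rewrite andbT.
  by apply: contraNneq bA => /val_inj <-.
(* Suppose that a point [x] before [k] is cut off from [a]. Its path to [b] contains an edge [u v]
   passing over [k], and the path from [k] to [a] leaves the points strictly between [u] and [v] by
   an edge [s t]. As [t] is neither [u] nor [v], the two edges cross. *)
have low x : a <= x <= k -> connect (adj E') a x.
  move=> axk; apply/negPn/negP => nax.
  have xb : connect (adj E') x b by apply: AorB => //; ord_lia.
  have notA u : connect (adj E') x u -> ~~ connect (adj E') a u.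
    move=> xu; apply: contra nax => /connect_trans; apply.
    by rewrite connectC.
  have xk : x < k.
    rewrite ltn_neqAle; case/andP: axk => _ ->; rewrite andbT.
    by apply: contraNneq nax => /val_inj ->.
  have [|u [v [xu uv ltuk]]] := @exit_edge _ _ (fun v : point => v < k) _ _ xb xk.
    by rewrite -leqNgt ltnW.
  rewrite -leqNgt => lekv.
  have xv : connect (adj E') x v := connect_trans xu (connect1 uv).
  have ltkv : k < v.
    rewrite ltn_neqAle lekv andbT; apply: contraNneq (notA _ xv).
    by move=> /val_inj <-.
  have ka : connect (adj E') k a by rewrite connectC.
  have kuv : u < k < v by ord_lia.
  have ua : a <= u <= b.
    by have [? ? ? ?] := itv_adj (nctree_graph nE) (E'E _ _ uv); ord_lia.
  have [|s [t [ks st suv ntuv]]] :=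
    @exit_edge _ _ (fun w : point => u < w < v) _ _ ka kuv.
    by ord_lia.
  have as_ : connect (adj E') a s := connect_trans kA ks.
  have at_ : connect (adj E') a t := connect_trans as_ (connect1 st).
  have tu : t != u by apply: contraTneq at_ => ->; apply: notA.
  have tv : t != v by apply: contraTneq at_ => ->; apply: notA.
  move: tu tv; rewrite -!val_eqE /= => tu tv.
  case: (ltnP t u) => ltu.
    apply: (nc t u s v) => //; try ord_lia; last exact: E'E.
    by rewrite adjC; apply: E'E.
  apply: (nc u s v t) => //; try ord_lia; exact: E'E.
exists k; apply/splitsP; split; first by ord_lia.
move=> x y xy ne xky.
have xy' : adj E' x y by rewrite adjD1 ne.
have [? ? ? ?] := itv_adj (nctree_graph nE) xy.
have ax : connect (adj E') a x by apply: low; ord_lia.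
(* An edge over the gap would put [y] in the component of [a], beyond its last point. *)
have := kmax y (connect_trans ax (connect1 xy')).
by ord_lia.
Qed.

Lemma graph_on_restr_nctree a b I E : nctree a b E -> graph_on I (restr E I).
Proof. by move=> /nctree_graph; apply: graph_on_restr. Qed.

Lemma split_glue a b k k' E : nctree a b E -> adj E a b -> splits a b k E ->
  k' = k.+1 :> nat -> E = glue a b (restr E (itv a k)) (restr E (itv k' b)).
Proof.
move=> nE ab /splitsP[akb sp] kk'.
have ak : a <= k by lia.
have kb : k' <= b by lia.
have g1 : graph_on (itv a k) (restr E (itv a k)) := graph_on_restr_nctree _ nE.
have g2 : graph_on (itv k' b) (restr E (itv k' b)) := graph_on_restr_nctree _ nE.
apply: (graph_eq (nctree_graph nE)).
  by apply: glue_graph ak kk' kb g1 g2.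
move=> x y; rewrite (adj_glue _ _ ak kk' kb).
rewrite !adj_restr !inE.
apply/idP/idP => [xy|].
  case: (boolP ([set x; y] == [set a; b])); first by rewrite eq_set2 => ->.
  move=> ne; rewrite xy /=; apply/orP; right.
  have [? ? ? ?] := itv_adj (nctree_graph nE) xy.
  have s1 := sp x y xy ne.
  have s2 : ~ (y <= k < x) by apply: sp; rewrite 1?adjC // setUC.
  by lia.
case/orP=> [/orP[]/andP[/eqP-> /eqP->]//|/orP[]/andP[]//].
by rewrite adjC.
Qed.

Lemma nctree_unglue_restr a b k k' E : nctree a b E -> adj E a b -> splits a b k E ->
    k' = k.+1 :> nat ->
  nctree a k (restr E (itv a k)) /\ nctree k' b (restr E (itv k' b)).
Proof.
move=> nE ab sp kk'; have /splitsP[akb _] := sp.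
have ak : a <= k by lia.
have kb : k' <= b by lia.
apply: (nctree_unglue ak kk' kb (graph_on_restr_nctree _ nE) (graph_on_restr_nctree _ nE)).
by rewrite -(split_glue nE ab sp kk').
Qed.

Section GlueRestr.

Variables (a b k k' : point) (E1 E2 : graph).
Hypotheses (ak : a <= k) (kk' : k' = k.+1 :> nat) (kb : k' <= b).
Hypotheses (gE1 : graph_on (itv a k) E1) (gE2 : graph_on (itv k' b) E2).

Lemma glue_splits : splits a b k (glue a b E1 E2).
Proof.
apply/splitsP; split; first by lia.
move=> x y /(adj_glueP ak kk' kb)[[-> ->]|[-> ->]|xy|xy].
- by rewrite eqxx.
- by rewrite setUC eqxx.
- by have [? ? ? ?] := itv_adj gE1 xy; lia.
- by have [? ? ? ?] := itv_adj gE2 xy; lia.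
Qed.

Lemma restr_glue1 : restr (glue a b E1 E2) (itv a k) = E1.
Proof.
have gE := glue_graph ak kk' kb gE1 gE2.
apply: (graph_eq (graph_on_restr _ gE) gE1) => x y.
rewrite adj_restr !inE; apply/idP/idP.
  case/and3P=> /(adj_glueP ak kk' kb)[[-> ->]|[-> ->]|xy|xy] //; try lia.
  by have [? ? ? ?] := itv_adj gE2 xy; lia.
move=> xy; have [-> -> -> ->] := itv_adj gE1 xy.
by rewrite (adj_sub _ xy) //; apply: glue_sub1.
Qed.

Lemma restr_glue2 : restr (glue a b E1 E2) (itv k' b) = E2.
Proof.
have gE := glue_graph ak kk' kb gE1 gE2.
apply: (graph_eq (graph_on_restr _ gE) gE2) => x y.
rewrite adj_restr !inE; apply/idP/idP.
  case/and3P=> /(adj_glueP ak kk' kb)[[-> ->]|[-> ->]|xy|xy] //; try lia.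
  by have [? ? ? ?] := itv_adj gE1 xy; lia.
move=> xy; have [-> -> -> ->] := itv_adj gE2 xy.
by rewrite (adj_sub _ xy) //; apply: glue_sub2.
Qed.

End GlueRestr.

Section JoinRestr.

Variables (a b c : point) (E1 E2 : graph).
Hypotheses (ac : a <= c) (cb : c <= b).
Hypotheses (gE1 : graph_on (itv a c) E1) (gE2 : graph_on (itv c b) E2).

Lemma restr_join1 : restr (E1 :|: E2) (itv a c) = E1.
Proof.
have gE := join_graph ac cb gE1 gE2.
apply: (graph_eq (graph_on_restr _ gE) gE1) => x y.
rewrite adj_restr !inE; apply/idP/idP.
  rewrite adjU => /and3P[/orP[//|xy]].
  have [? ? ? ?] := itv_adj gE2 xy; move: xy.
  rewrite /adj -val_eqE /=; lia.
move=> xy; have [-> -> -> ->] := itv_adj gE1 xy.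
by rewrite adjU xy.
Qed.

Lemma restr_join2 : restr (E1 :|: E2) (itv c b) = E2.
Proof.
have gE := join_graph ac cb gE1 gE2.
apply: (graph_eq (graph_on_restr _ gE) gE2) => x y.
rewrite adj_restr !inE; apply/idP/idP.
  rewrite adjU => /and3P[/orP[xy|//]].
  have [? ? ? ?] := itv_adj gE1 xy; move: xy.
  rewrite /adj -val_eqE /=; lia.
move=> xy; have [-> -> -> ->] := itv_adj gE2 xy.
by rewrite adjU xy orbT.
Qed.

End JoinRestr.

Lemma unjoin_restr a b c E : nctree a b E -> a <= c <= b ->
    (forall x y, adj E x y -> x < c < y -> False) ->
  E = restr E (itv a c) :|: restr E (itv c b).
Proof.
move=> nE /[dup] acb /andP[ac cb] noc.
apply: (graph_eq (nctree_graph nE)).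
  by apply: (join_graph ac cb); apply: graph_on_restr_nctree nE.
move=> x y; rewrite adjU !adj_restr !inE; apply/idP/idP => [xy|].
  have [? ? ? ?] := itv_adj (nctree_graph nE) xy.
  have := noc _ _ xy; have yx : adj E y x by rewrite adjC.
  by have := noc _ _ yx; rewrite xy /=; lia.
by case/orP=> /andP[].
Qed.

Lemma nctree_unjoin_restr a b c E : nctree a b E -> a <= c <= b ->
    (forall x y, adj E x y -> x < c < y -> False) ->
  nctree a c (restr E (itv a c)) /\ nctree c b (restr E (itv c b)).
Proof.
move=> nE /[dup] acb /andP[ac cb] noc.
apply: (nctree_unjoin ac cb (graph_on_restr_nctree _ nE) (graph_on_restr_nctree _ nE)).
by rewrite -unjoin_restr.
Qed.

Definition last_nbr a c E := adj E a c && [forall x, adj E a x ==> (x <= c)].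
Definition first_nbr b c E := adj E b c && [forall x, adj E b x ==> (c <= x)].

Lemma last_nbrP a c E :
  reflect (adj E a c /\ forall x, adj E a x -> x <= c) (last_nbr a c E).
Proof.
apply: (iffP andP) => -[ac mx]; split=> //; first by move=> x; apply/implyP/(forallP mx).
by apply/forallP => x; apply/implyP/mx.
Qed.

Lemma first_nbrP b c E :
  reflect (adj E b c /\ forall x, adj E b x -> c <= x) (first_nbr b c E).
Proof.
apply: (iffP andP) => -[ac mx]; split=> //; first by move=> x; apply/implyP/(forallP mx).
by apply/forallP => x; apply/implyP/mx.
Qed.

Lemma last_nbr_uniq a c c' E : last_nbr a c E -> last_nbr a c' E -> c = c'.
Proof.
move=> /last_nbrP[ac cmax] /last_nbrP[ac' cmax']; apply: val_inj => /=.
by have := cmax _ ac'; have := cmax' _ ac; lia.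
Qed.

Lemma first_nbr_uniq a c c' E : first_nbr a c E -> first_nbr a c' E -> c = c'.
Proof.
move=> /first_nbrP[ac cmax] /first_nbrP[ac' cmax']; apply: val_inj => /=.
by have := cmax _ ac'; have := cmax' _ ac; lia.
Qed.

Lemma nctree_neighbour a b E u v : nctree a b E -> a <= u <= b -> a <= v <= b ->
  u != v -> exists x, adj E u x.
Proof.
move=> nE uab vab uv.
have cuv := nctree_connect nE uab vab.
have [||w [x [_ wx /eqP wu _]]] := @exit_edge _ _ (pred1 u) _ _ cuv.
- by rewrite /= eqxx.
- by rewrite /= eq_sym.
- by exists x; rewrite -wu.
Qed.

Lemma last_nbr_exists a b E : nctree a b E -> a < b -> exists c, last_nbr a c E.
Proof.
move=> nE ab.
have [||| x ax] := @nctree_neighbour a b E a b nE; rewrite -?val_eqE /=; try ord_lia.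
case: (arg_maxnP (fun v : point => v : nat) ax) => c ac cmax.
by exists c; apply/last_nbrP.
Qed.

Lemma first_nbr_exists a b E : nctree a b E -> a < b -> exists c, first_nbr b c E.
Proof.
move=> nE ab.
have [||| x bx] := @nctree_neighbour a b E b a nE; rewrite -?val_eqE /=; try ord_lia.
case: (arg_minnP (fun v : point => v : nat) bx) => c bc cmin.
by exists c; apply/first_nbrP.
Qed.

(** An edge passing over [c] either starts at [a], against the choice of [c] as furthest neighbour,
    or crosses {a, c}. *)
Lemma last_nbr_nocross a b c E : nctree a b E -> last_nbr a c E ->
  forall x y, adj E x y -> x < c < y -> False.
Proof.
move=> nE /last_nbrP[ac cmax] x y xy xcy.
have [? ? ? ?] := itv_adj (nctree_graph nE) xy.
have [xa|xa] := eqVneq x a.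
  by have := cmax y; rewrite -xa => /(_ xy); ord_lia.
have /noncrossingP nc := proj2 (andP nE).
by apply: (nc a x c y) => //; move: xa; rewrite -val_eqE /=; ord_lia.
Qed.

Lemma first_nbr_nocross a b c E : nctree a b E -> first_nbr b c E ->
  forall x y, adj E x y -> x < c < y -> False.
Proof.
move=> nE /first_nbrP[bc cmin] x y xy xcy.
have [? ? ? ?] := itv_adj (nctree_graph nE) xy.
have [yb|yb] := eqVneq y b.
  by have := cmin x; rewrite -yb adjC => /(_ xy); ord_lia.
have /noncrossingP nc := proj2 (andP nE).
apply: (nc x c y b) => //; try ord_lia; last by rewrite adjC.
by move: yb; rewrite -val_eqE /=; ord_lia.
Qed.

(** If the furthest neighbour [c] of the root were not [b], the part of the tree on [c], ..., [b]
    would give [c] a neighbour [z] beyond it, and [a], [c], [z] would form two ascents. *)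
Lemma avoid_up_adj a b E : nctree a b E -> avoid true a E -> a < b -> adj E a b.
Proof.
move=> nE /avoidP av ab; have [c /[dup] lc /last_nbrP[ac cmax]] := last_nbr_exists nE ab.
have [? ? ? ?] := itv_adj (nctree_graph nE) ac.
have [<-//|cb] := eqVneq c b.
have noc := last_nbr_nocross nE lc.
have acb : a <= c <= b by ord_lia.
have g2 := graph_on_restr (itv c b) (nctree_graph nE).
have [_ n2] := nctree_unjoin_restr nE acb noc.
have [||z cz] := nctree_neighbour (u := c) (v := b) n2 _ _ cb; try ord_lia.
have [_ _ ? ?] := itv_adj g2 cz.
have acne : a != c by move: ac => /andP[].
move: cz; rewrite adj_restr => /andP[cz _].
have czne : c != z by move: cz => /andP[].
case: (av a c z).
- by rewrite /par ac connect0.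
- rewrite /par cz; apply: connect1; rewrite adjD1 ac andbT eq_set2.
  by move: acne czne; rewrite -!val_eqE /=; ord_lia.
- by rewrite /ltd; move: acne; rewrite -val_eqE /=; ord_lia.
- by rewrite /ltd; move: czne; rewrite -val_eqE /=; ord_lia.
Qed.

Lemma avoid_down_adj a b E : nctree a b E -> avoid false b E -> a < b -> adj E a b.
Proof.
move=> nE /avoidP av ab; have [c /[dup] lc /first_nbrP[bc cmin]] := first_nbr_exists nE ab.
have [? ? ? ?] := itv_adj (nctree_graph nE) bc.
have [<-|ca] := eqVneq c a; first by rewrite adjC.
have noc := first_nbr_nocross nE lc.
have acb : a <= c <= b by ord_lia.
have g1 := graph_on_restr (itv a c) (nctree_graph nE).
have [n1 _] := nctree_unjoin_restr nE acb noc.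
have [||z cz] := nctree_neighbour (u := c) (v := a) n1 _ _ ca; try ord_lia.
have [_ _ ? ?] := itv_adj g1 cz.
have bcne : b != c by move: bc => /andP[].
move: cz; rewrite adj_restr => /andP[cz _].
have czne : c != z by move: cz => /andP[].
case: (av b c z).
- by rewrite /par bc connect0.
- rewrite /par cz; apply: connect1; rewrite adjD1 bc andbT eq_set2.
  by move: bcne czne; rewrite -!val_eqE /=; ord_lia.
- by rewrite /ltd; move: bcne; rewrite -val_eqE /=; ord_lia.
- by rewrite /ltd; move: czne; rewrite -val_eqE /=; ord_lia.
Qed.

End Decomposition.

(** * Recurrences for the numbers of trees *)

Lemma card_in_bij (T T' : finType) (A : {set T}) (B : {set T'}) f g :
    {in A, forall x, f x \in B} -> {in B, forall y, g y \in A} ->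
    {in A, cancel f g} -> {in B, cancel g f} ->
  #|A| = #|B|.
Proof.
move=> fB gA fK gK.
have -> : B = f @: A.
  apply/setP => y; apply/idP/imsetP => [yB|[x xA ->]]; last exact: fB.
  by exists (g y); rewrite ?gA ?gK.
by rewrite (card_in_imset (can_in_inj fK)).
Qed.

Lemma sum_uniq (T I : finType) (A : {set T}) (B : I -> {pred T}) :
    (forall t, t \in A -> exists i, t \in B i) ->
    (forall t i j, t \in A -> t \in B i -> t \in B j -> i = j) ->
  #|A| = \sum_i #|[set t in A | t \in B i]|.
Proof.
move=> exB unB; rewrite -sum1_card.
under [RHS]eq_bigr => i _ do rewrite -sum1_card.
under [RHS]eq_bigr => i _ do under eq_bigl => t do rewrite inE.
rewrite (exchange_big_dep (mem A)) /=; last by move=> i t _ /andP[].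
apply: eq_bigr => t tA; have [i ti] := exB t tA.
rewrite (bigD1 i) /=; last by rewrite tA.
rewrite big1 // => j /andP[/andP[_ tj] ji].
by rewrite (unB t i j tA ti tj) eqxx in ji.
Qed.

Section Counting.

Variable n : nat.
Notation point := 'I_n.+1.
Notation graph := {set {set point}}.
Notation gapset := {set point}.
Implicit Types (E F : graph) (S : gapset) (a b c k r u v x y z : point).
Implicit Types (d : bool) (t : graph * gapset).

(* [g] stands for the gap between the points [g] and [g.+1]. *)
Definition gaps a b : gapset := [set g : point | a <= g < b].

(** With [S] read as the set of places where the label goes up, this says that no edge is a
    level. *)
Definition strict E S :=
  [forall x, forall y, adj E x y && (x < y) ==> [exists g in S, x <= g < y]].

Lemma strictP E S :
  reflect (forall x y, adj E x y -> x < y -> exists2 g, g \in S & x <= g < y)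
          (strict E S).
Proof.
apply: (iffP forallP) => [st x y xy lxy|st x].
  have /forallP/(_ y) := st x; rewrite xy lxy => /existsP[g /andP[gS gxy]].
  by exists g.
apply/forallP => y; apply/implyP => /andP[xy lxy].
by have [g gS gxy] := st x y xy lxy; apply/existsP; exists g; rewrite gS.
Qed.

Lemma strict_restr a b E S : strict E S ->
  strict (restr E (itv a b)) (S :&: gaps a b).
Proof.
move=> /strictP st; apply/strictP => x y; rewrite adj_restr !inE.
move=> /and3P[xy xab yab] lxy; have [g gS gxy] := st x y xy lxy.
by exists g => //; rewrite !inE gS /=; ord_lia.
Qed.

Definition avoider d r a b t :=
  [&& nctree a b t.1, avoid d r t.1, t.2 \subset gaps a b & strict t.1 t.2].

Definition avoiders d r a b := [set t | avoider d r a b t].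
(* By [avoid_edge], rooting at [b] instead of [a] gives the same set. *)
Definition edge_avoiders d a b := [set t | avoider d a a b t && adj t.1 a b].

Lemma nctree_point a E : nctree a a E -> E = set0.
Proof.
move=> nE; apply: (graph_eq (J := set0) (nctree_graph nE)).
  by apply/forallP => e; rewrite inE.
move=> x y; rewrite /adj inE andbF; apply/negP => xy.
have [? ? ? ?] := itv_adj (nctree_graph nE) xy.
by case/andP: xy; rewrite -val_eqE /=; ord_lia.
Qed.

Lemma gaps_point a S : S \subset gaps a a -> S = set0.
Proof.
move=> /subsetP Sa; apply/setP => g; rewrite inE; apply/negP => /Sa.
by rewrite inE; ord_lia.
Qed.

Lemma card_avoiders_point d r a : #|avoiders d r a a| = 1.
Proof.
rewrite -(cards1 (set0 : graph, set0 : gapset)); congr #|pred_of_set _|.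
apply/setP => -[E S]; rewrite !inE; apply/idP/eqP.
  by case/and4P=> /= /nctree_point -> _ /gaps_point ->.
case=> -> ->; have no x y : adj (set0 : graph) x y = false by rewrite /adj inE andbF.
apply/and4P; split=> //=.
- apply/andP; split; last by apply/noncrossingP => w x y z; rewrite no.
  apply/tree_onP; split; first by apply/forallP => e; rewrite inE.
    move=> x y; rewrite !inE => xa ya.
    suff -> : x = y by apply: connect0.
    by apply: val_inj => /=; ord_lia.
  by apply: bridge_acyclic => x y; rewrite no.
- by apply/avoidP => x y z; rewrite /par no.
- exact: sub0set.
- by apply/strictP => x y; rewrite no.
Qed.

(** The gap at [k] lies in neither part, hence the separate boolean. *)
Definition split_fun a b k k' t :=
  ((restr t.1 (itv a k), t.2 :&: gaps a k),
   (restr t.1 (itv k' b), t.2 :&: gaps k' b), k \in t.2).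

Definition glue_fun a b k (p : (graph * gapset) * (graph * gapset) * bool) :=
  (glue a b p.1.1.1 p.1.2.1,
   p.1.1.2 :|: p.1.2.2 :|: (if p.2 then [set k] else set0)).

Lemma avoider_gap d r a b t : avoider d r a b t -> a < b -> exists g, g \in t.2.
Proof.
case/and4P=> nE _ _ /strictP st ab.
have [||| x ax] := @nctree_neighbour _ a b t.1 a b nE; rewrite -?val_eqE /=; try ord_lia.
have [? ? ? ?] := itv_adj (nctree_graph nE) ax.
have [|g gS _] := st _ _ ax; last by exists g.
by case/andP: ax; rewrite -val_eqE /=; ord_lia.
Qed.

(** The strictness of the gap at [k] is a free choice once another strict gap lies under {a, b}, and
    any part with more than one point provides one. If both parts are points, this is the only gap
    under {a, b} and must be strict, hence the last factor. *)
Lemma card_edge_avoiders_split d a b k k' : a <= k < b -> k' = k.+1 :> nat ->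
  #|[set t in edge_avoiders d a b | splits a b k t.1]| =
  #|avoiders d a a k| * #|avoiders d b k' b| * (if a.+1 == b then 1 else 2).
Proof.
move=> akb kk'.
have ak : a <= k by ord_lia.
have kb : k' <= b by ord_lia.
(* The values allowed for the boolean of [split_fun]. *)
pose T := if a.+1 == b then [set true] else [set: bool].
have -> : (if a.+1 == b then 1 else 2) = #|T|.
  by rewrite /T; case: ifP; rewrite ?cards1 ?cardsT ?card_bool.
rewrite -!cardsX.
apply: (@card_in_bij _ _ _ _ (split_fun a b k k') (glue_fun a b k)).
- move=> [E S]; rewrite !inE /= => /andP[/andP[/and4P[/= nE av gS st] ab] sp].
  have [n1 n2] := nctree_unglue_restr nE ab sp kk'.
  have g1 := nctree_graph n1; have g2 := nctree_graph n2.
  have /andP[av1 av2] :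
      avoid d a (restr E (itv a k)) && avoid d b (restr E (itv k' b)).
    rewrite -(avoid_glue ak kk' kb g1 g2 d (or_introl (erefl a))).
    by rewrite -(split_glue nE ab sp kk').
  rewrite /avoider /= n1 n2 av1 av2 !subsetIr !strict_restr //=.
  rewrite /T; case: ifP => [/eqP ab1|]; rewrite ?inE //.
  have /strictP/(_ a b ab) := st; case; first by ord_lia.
  move=> g gS' gab.
  suff -> : k = g by rewrite gS'.
  by apply: val_inj => /=; ord_lia.
- move=> [[[E1 S1] [E2 S2]] bt]; rewrite !inE /=.
  case/andP=> /andP[go1 go2] btT.
  pose S := S1 :|: S2 :|: (if bt then [set k] else set0).
  case/and4P: (go1) => /= n1 av1 /subsetP gS1 st1.
  case/and4P: (go2) => /= n2 av2 /subsetP gS2 st2.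
  have gE1 := nctree_graph n1; have gE2 := nctree_graph n2.
  have gS g : g \in S -> a <= g < b.
    rewrite !inE => /orP[/orP[/gS1|/gS2]|]; rewrite ?inE; try ord_lia.
    by case: (bt); rewrite inE // => /eqP->; ord_lia.
  have [g0 g0S] : exists g, g \in S.
    move: btT; rewrite /T; case: ifP => [_|ab1 _].
      by rewrite inE => /eqP bt1; exists k; rewrite !inE bt1 inE eqxx orbT.
    have [ltak|ltkb] : a < k \/ k' < b by move: ab1; ord_lia.
      by have [g gS1'] := avoider_gap go1 ltak; exists g; rewrite !inE gS1'.
    by have [g gS2'] := avoider_gap go2 ltkb; exists g; rewrite !inE gS2' orbT.
  rewrite (glue_splits ak kk' kb gE1 gE2) andbT (adj_glue _ _ ak kk' kb).
  rewrite !eqxx andbT /avoider /= (nctree_glue ak kk' kb gE1 gE2) //=.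
  rewrite (avoid_glue ak kk' kb gE1 gE2); last by left.
  rewrite av1 av2 /= ?andbT; apply/andP; split.
    by apply/subsetP => g /gS; rewrite inE.
  apply/strictP => x y /(adj_glueP ak kk' kb)[[-> ->]|[-> ->]|xy|xy] lxy.
  + by exists g0 => //; apply: gS.
  + by ord_lia.
  + by have [g gS' gxy] := strictP _ _ st1 _ _ xy lxy; exists g; rewrite // !inE gS'.
  + by have [g gS' gxy] := strictP _ _ st2 _ _ xy lxy; exists g; rewrite // !inE gS' orbT.
- move=> [E S]; rewrite !inE /= => /andP[/andP[/and4P[/= nE av gS st] ab] sp].
  rewrite /glue_fun /split_fun /= -(split_glue nE ab sp kk'); congr pair.
  apply/setP => g; rewrite !inE; case: (boolP (g \in S)) => gS' /=.
    have := subsetP gS g gS'; rewrite inE => agb.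
    have [gk|gk] := eqVneq g k; first by rewrite -gk gS' inE eqxx orbT.
    by move: gk; rewrite -val_eqE /=; ord_lia.
  by case: ifP => kS; rewrite inE //; apply: contraNF gS' => /eqP->.
- move=> [[[E1 S1] [E2 S2]] bt]; rewrite !inE /=.
  case/andP=> /andP[/and4P[/= n1 av1 gS1 st1] /and4P[/= n2 av2 gS2 st2]] btT.
  have gE1 := nctree_graph n1; have gE2 := nctree_graph n2.
  have S1P g : g \in S1 -> a <= g < k by move/(subsetP gS1); rewrite inE.
  have S2P g : g \in S2 -> k' <= g < b by move/(subsetP gS2); rewrite inE.
  have btP g : g \in (if bt then [set k] else set0) = bt && (g == k).
    by case: (bt); rewrite inE.
  rewrite /split_fun /= (restr_glue1 ak kk' kb) //
    (restr_glue2 ak kk' kb) // !inE btP eqxx andbT.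
  congr (((_, _), (_, _)), _).
  + apply/setP => g; rewrite !inE btP -val_eqE /=.
    have := S1P g; have := S2P g.
    by case: (g \in S1); case: (g \in S2); case: (bt); ord_lia.
  + apply/setP => g; rewrite !inE btP -val_eqE /=.
    have := S1P g; have := S2P g.
    by case: (g \in S1); case: (g \in S2); case: (bt); ord_lia.
  + have := S1P k; have := S2P k.
    by case: (k \in S1); case: (k \in S2); case: (bt); ord_lia.
Qed.

Lemma card_edge_avoiders d a b : a < b ->
  #|edge_avoiders d a b| = \sum_(k : point | a <= k < b)
    #|avoiders d a a k| * #|avoiders d b (inord k.+1) b| * (if a.+1 == b then 1 else 2).
Proof.
move=> ab.
rewrite (@sum_uniq _ _ _ (fun k => [pred t | splits a b k t.1])).
- rewrite [LHS](bigID (fun k : point => a <= k < b)) /= [X in _ + X]big1.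
    rewrite addn0; apply: eq_bigr => k akb.
    have kk' : (inord k.+1 : point) = k.+1 :> nat.
      by rewrite inordK //; have := ltn_ord b; ord_lia.
    by rewrite -(card_edge_avoiders_split d akb kk'); apply: eq_card => t; rewrite !inE.
  move=> k nakb; apply/eqP; rewrite cards_eq0; apply/eqP/setP => t; rewrite !inE.
  by apply/negP => /andP[_ /splitsP[akb _]]; rewrite akb in nakb.
- move=> t; rewrite inE => /andP[/and4P[nE _ _ _] abE].
  by have [k kP] := split_exists nE abE ab; exists k.
- move=> t j k; rewrite inE => /andP[/and4P[nE _ _ _] _].
  exact: split_uniq nE.
Qed.

Lemma avoiders_edge_up a b : a < b -> avoiders true a a b = edge_avoiders true a b.
Proof.
move=> ab; apply/setP => t; rewrite !inE; apply/idP/andP => [gt|[]//].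
by split=> //; case/and4P: gt => nE av _ _; apply: avoid_up_adj.
Qed.

(** Whichever end is the root, the left part is entered at [a] and the right part at [b], so
    [avoid_glue] gives the same condition. *)
Lemma avoid_edge d a b E : nctree a b E -> adj E a b -> a < b ->
  avoid d b E = avoid d a E.
Proof.
move=> nE abE ab; have [k sp] := split_exists nE abE ab.
have /splitsP[akb _] := sp.
have kk' : (inord k.+1 : point) = k.+1 :> nat.
  by rewrite inordK //; have := ltn_ord b; ord_lia.
have ak : a <= k by ord_lia.
have kb : (inord k.+1 : point) <= b by rewrite kk'; ord_lia.
have [n1 n2] := nctree_unglue_restr nE abE sp kk'.
rewrite (split_glue nE abE sp kk').
by rewrite !(avoid_glue ak kk' kb (nctree_graph n1) (nctree_graph n2)); [|left|right].
Qed.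

Lemma avoiders_edge_down a b : a < b -> avoiders false b a b = edge_avoiders false a b.
Proof.
move=> ab; apply/setP => t; rewrite !inE /avoider; apply/idP/andP => [|[]].
  case/and4P=> nE av gt st; have abE := avoid_down_adj nE av ab.
  by rewrite nE gt st -(avoid_edge _ nE abE ab) av.
by case/and4P=> nE av gt st abE; rewrite nE gt st (avoid_edge _ nE abE ab) av.
Qed.

Definition unjoin_fun a b c t :=
  ((restr t.1 (itv a c), t.2 :&: gaps a c),
   (restr t.1 (itv c b), t.2 :&: gaps c b)).

Definition join_fun (p : (graph * gapset) * (graph * gapset)) :=
  (p.1.1 :|: p.2.1, p.1.2 :|: p.2.2).

Lemma unjoin_funK a b c t : a <= c <= b -> nctree a b t.1 -> t.2 \subset gaps a b ->
    (forall x y, adj t.1 x y -> x < c < y -> False) ->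
  join_fun (unjoin_fun a b c t) = t.
Proof.
case: t => E S /= acb nE /subsetP gS noc; rewrite /join_fun /= -unjoin_restr //.
congr pair; apply/setP => g; rewrite !inE -andb_orr.
by apply/andP/idP => [[]//|gS']; split=> //; have := gS g gS'; rewrite inE; ord_lia.
Qed.

Lemma join_funK a b c (p : (graph * gapset) * (graph * gapset)) : a <= c <= b ->
    nctree a c p.1.1 -> nctree c b p.2.1 -> p.1.2 \subset gaps a c ->
    p.2.2 \subset gaps c b ->
  unjoin_fun a b c (join_fun p) = p.
Proof.
case: p => [[E1 S1] [E2 S2]] /= /andP[ac cb] n1 n2 /subsetP gS1 /subsetP gS2.
rewrite /unjoin_fun /= (restr_join1 ac cb (nctree_graph n1) (nctree_graph n2)).
rewrite (restr_join2 ac cb (nctree_graph n1) (nctree_graph n2)).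
congr ((_, _), (_, _)); apply/setP => g; rewrite !inE;
  have := gS1 g; have := gS2 g; rewrite !inE;
  by case: (g \in S1); case: (g \in S2); ord_lia.
Qed.

Lemma strict_join E1 E2 S1 S2 : strict E1 S1 -> strict E2 S2 ->
  strict (E1 :|: E2) (S1 :|: S2).
Proof.
move=> /strictP st1 /strictP st2; apply/strictP => x y; rewrite adjU => /orP[] xy lxy.
  by have [g gS gxy] := st1 x y xy lxy; exists g; rewrite // inE gS.
by have [g gS gxy] := st2 x y xy lxy; exists g; rewrite // inE gS orbT.
Qed.

Lemma gaps_join a b c S1 S2 : a <= c <= b -> S1 \subset gaps a c ->
  S2 \subset gaps c b -> S1 :|: S2 \subset gaps a b.
Proof.
move=> acb /subsetP gS1 /subsetP gS2; apply/subsetP => g; rewrite !inE.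
by case/orP=> [/gS1|/gS2]; rewrite inE; ord_lia.
Qed.

(** The part on [c], ..., [b] contains {c, b} and may be rooted at either end by [avoid_edge]; the
    part on [a], ..., [c] hangs from its rightmost point, and no condition links the two. *)
Lemma card_avoiders_first a b c : a <= c < b ->
  #|[set t in avoiders true b a b | first_nbr b c t.1]| =
  #|avoiders true c a c| * #|edge_avoiders true c b|.
Proof.
move=> acb'; rewrite -cardsX.
have acb : a <= c <= b by ord_lia.
have ac : a <= c by ord_lia.
have cb : c <= b by ord_lia.
have ltcb : c < b by ord_lia.
apply: (@card_in_bij _ _ _ _ (unjoin_fun a b c) join_fun).
- move=> [E S]; rewrite !inE /= => /andP[/and4P[/= nE av gS st] fi].
  have noc := first_nbr_nocross nE fi; have /first_nbrP[bc _] := fi.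
  have [n1 n2] := nctree_unjoin_restr nE acb noc.
  have cbE2 : adj (restr E (itv c b)) c b.
    by rewrite adj_restr adjC bc !inE; ord_lia.
  have /andP[av1 av2] :
      avoid true c (restr E (itv a c)) && avoid true b (restr E (itv c b)).
    rewrite -(avoid_join_up ac cb (nctree_graph n1) (nctree_graph n2) n1 n2).
    by rewrite -(unjoin_restr nE acb noc).
  rewrite /avoider /= n1 n2 av1 -(avoid_edge _ n2 cbE2 ltcb) av2.
  by rewrite !subsetIr !strict_restr.
- move=> [[E1 S1] [E2 S2]]; rewrite !inE /=.
  case/andP=> /and4P[/= n1 av1 gS1 st1] /andP[/and4P[/= n2 av2 gS2 st2] cbE2].
  have g1 := nctree_graph n1; have g2 := nctree_graph n2.
  rewrite /avoider /= (nctree_join ac cb g1 g2) //= (avoid_join_up ac cb g1 g2 n1 n2) av1.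
  rewrite (avoid_edge _ n2 cbE2 ltcb) av2 (gaps_join acb) // strict_join //=.
  apply/first_nbrP; rewrite adjU [adj E2 _ _]adjC cbE2 orbT; split=> // x.
  rewrite adjU => /orP[] bx; last by have [] := itv_adj g2 bx.
  by have [] := itv_adj g1 bx; ord_lia.
- move=> t; rewrite !inE => /andP[/and4P[/= nE av gS st] fi].
  by apply: unjoin_funK => //; apply: first_nbr_nocross nE fi.
- move=> p; rewrite !inE => /andP[/and4P[n1 _ gS1 _] /andP[/and4P[n2 _ gS2 _] _]].
  exact: join_funK.
Qed.

Lemma card_avoiders_last a b c : a < c <= b ->
  #|[set t in avoiders false a a b | last_nbr a c t.1]| =
  #|edge_avoiders false a c| * #|avoiders false c c b|.
Proof.
move=> acb'; rewrite -cardsX.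
have acb : a <= c <= b by ord_lia.
have ac : a <= c by ord_lia.
have cb : c <= b by ord_lia.
have ltac : a < c by ord_lia.
apply: (@card_in_bij _ _ _ _ (unjoin_fun a b c) join_fun).
- move=> [E S]; rewrite !inE /= => /andP[/and4P[/= nE av gS st] la].
  have noc := last_nbr_nocross nE la; have /last_nbrP[acE _] := la.
  have [n1 n2] := nctree_unjoin_restr nE acb noc.
  have acE1 : adj (restr E (itv a c)) a c.
    by rewrite adj_restr acE !inE; ord_lia.
  have /andP[av1 av2] :
      avoid false a (restr E (itv a c)) && avoid false c (restr E (itv c b)).
    rewrite -(avoid_join_down ac cb (nctree_graph n1) (nctree_graph n2) n1 n2).
    by rewrite -(unjoin_restr nE acb noc).
  by rewrite /avoider /= n1 n2 av1 av2 acE1 !subsetIr !strict_restr.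
- move=> [[E1 S1] [E2 S2]]; rewrite !inE /=.
  case/andP=> /andP[/and4P[/= n1 av1 gS1 st1] acE1] /and4P[/= n2 av2 gS2 st2].
  have g1 := nctree_graph n1; have g2 := nctree_graph n2.
  rewrite /avoider /= (nctree_join ac cb g1 g2) //= (avoid_join_down ac cb g1 g2 n1 n2) av1.
  rewrite av2 (gaps_join acb) // strict_join //=.
  apply/last_nbrP; rewrite adjU acE1; split=> // x.
  rewrite adjU => /orP[] ax; first by have [] := itv_adj g1 ax.
  by have [] := itv_adj g2 ax; ord_lia.
- move=> t; rewrite !inE => /andP[/and4P[/= nE av gS st] la].
  by apply: unjoin_funK => //; apply: last_nbr_nocross nE la.
- move=> p; rewrite !inE => /andP[/andP[/and4P[n1 _ gS1 _] _] /and4P[n2 _ gS2 _]].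
  exact: join_funK.
Qed.

Lemma card_avoiders_up a b : a < b ->
  #|avoiders true b a b| =
    \sum_(c : point | a <= c < b) #|avoiders true c a c| * #|edge_avoiders true c b|.
Proof.
move=> ab.
rewrite (@sum_uniq _ _ _ (fun c => [pred t | first_nbr b c t.1])).
- rewrite [LHS](bigID (fun k : point => a <= k < b)) /= [X in _ + X]big1.
    rewrite addn0; apply: eq_bigr => c acb.
    by rewrite -(card_avoiders_first acb); apply: eq_card => t; rewrite !inE.
  move=> c nacb; apply/eqP; rewrite cards_eq0; apply/eqP/setP => t; rewrite !inE.
  apply/negP => /andP[/and4P[nE _ _ _] /first_nbrP[bc _]].
  have [? ? ? ?] := itv_adj (nctree_graph nE) bc.
  by case/andP: bc; rewrite -val_eqE /=; ord_lia.
- move=> t; rewrite inE => /and4P[nE _ _ _].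
  by have [c cP] := first_nbr_exists nE ab; exists c.
- move=> t j k; rewrite inE => /and4P[nE _ _ _].
  exact: first_nbr_uniq.
Qed.

Lemma card_avoiders_down a b : a < b ->
  #|avoiders false a a b| =
    \sum_(c : point | a < c <= b) #|edge_avoiders false a c| * #|avoiders false c c b|.
Proof.
move=> ab.
rewrite (@sum_uniq _ _ _ (fun c => [pred t | last_nbr a c t.1])).
- rewrite [LHS](bigID (fun k : point => a < k <= b)) /= [X in _ + X]big1.
    rewrite addn0; apply: eq_bigr => c acb.
    by rewrite -(card_avoiders_last acb); apply: eq_card => t; rewrite !inE.
  move=> c nacb; apply/eqP; rewrite cards_eq0; apply/eqP/setP => t; rewrite !inE.
  apply/negP => /andP[/and4P[nE _ _ _] /last_nbrP[ac _]].
  have [? ? ? ?] := itv_adj (nctree_graph nE) ac.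
  by case/andP: ac; rewrite -val_eqE /=; ord_lia.
- move=> t; rewrite inE => /and4P[nE _ _ _].
  by have [c cP] := last_nbr_exists nE ab; exists c.
- move=> t j k; rewrite inE => /and4P[nE _ _ _].
  exact: last_nbr_uniq.
Qed.

End Counting.

(* Course-of-values recursion: [s] lists the pairs of counts of index less
   than [m]. *)
Definition next_counts (m : nat) (s : seq (nat * nat)) : nat * nat :=
  let x k := (nth (0, 0) s k).1 in
  let y k := (nth (0, 0) s k).2 in
  let xm := if m == 0 then 1 else
    (\sum_(k < m) x k * y (m.-1 - k)) * (if m == 1 then 1 else 2) in
  let ym := if m == 0 then 1 else
    \sum_(j < m) y j * (if j == 0 :> nat then xm else x (m - j)) in
  (xm, ym).

Fixpoint count_table (M : nat) : seq (nat * nat) :=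
  if M is m.+1 then rcons (count_table m) (next_counts m (count_table m))
  else [::].

Lemma size_count_table M : size (count_table M) = M.
Proof. by elim: M => //= M IH; rewrite size_rcons IH. Qed.

Definition counts m := nth (0, 0) (count_table m.+1) m.
Definition edge_count m := (counts m).1.
Definition chain_count m := (counts m).2.

Lemma nth_count_table M m : m < M -> nth (0, 0) (count_table M) m = counts m.
Proof.
elim: M => // M IH; rewrite ltnS leq_eqVlt => /orP[/eqP->//|mM].
by rewrite -(IH mM) /= nth_rcons size_count_table mM.
Qed.

Lemma countsE m : counts m = next_counts m (count_table m).
Proof. by rewrite /counts /= nth_rcons size_count_table ltnn eqxx. Qed.

Lemma edge_count0 : edge_count 0 = 1. Proof. by rewrite /edge_count countsE. Qed.
Lemma chain_count0 : chain_count 0 = 1. Proof. by rewrite /chain_count countsE. Qed.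

Lemma edge_countE m : 0 < m -> edge_count m =
  (\sum_(k < m) edge_count k * chain_count (m.-1 - k)) * (if m == 1 then 1 else 2).
Proof.
move=> m0; rewrite {1}/edge_count countsE /next_counts [_.1]/= eqn0Ngt m0.
congr (_ * _); apply: eq_bigr => k _.
by rewrite !nth_count_table //; lia.
Qed.

(** The term at [j = 0] needs the edge count of index [m] itself, which is not yet in the table;
    hence the case distinction in [next_counts]. *)
Lemma chain_countE m : 0 < m -> chain_count m =
  \sum_(j < m) chain_count j * edge_count (m - j).
Proof.
move=> m0; rewrite {1}/chain_count countsE.
have xE : (next_counts m (count_table m)).1 = edge_count m.
  by rewrite /edge_count countsE.
move: xE; rewrite /next_counts /= eqn0Ngt m0 => ->.
apply: eq_bigr => j _; rewrite nth_count_table //; congr (_ * _).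
case: ifP => [/eqP->|j0]; first by rewrite subn0.
by rewrite nth_count_table //; lia.
Qed.

Lemma sum_itv N (a b : nat) (H : nat -> nat) : b <= N ->
  \sum_(k < N | a <= k < b) H k = \sum_(j < b - a) H (a + j).
Proof.
move=> bN; rewrite -(big_mkord xpredT (fun j => H (a + j))).
rewrite -(big_mkord (fun k => a <= k < b) H).
have -> : \sum_(0 <= j < b - a) H (a + j) = \sum_(a <= i < b) H i.
  by rewrite -[in RHS](add0n a) big_addn; apply: eq_bigr => i _; rewrite addnC.
rewrite (big_nat_widen _ _ _ _ _ bN) (@big_nat_widenl _ _ _ a 0) //.
by apply: eq_bigl => i /=; rewrite andbC.
Qed.

Lemma sum_ord_rev m (H : nat -> nat) :
  \sum_(j < m) H j = \sum_(j < m) H (m.-1 - j).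
Proof.
rewrite (reindex_inj rev_ord_inj) /=; apply: eq_bigr => j _; congr H.
by have := ltn_ord j; lia.
Qed.

(** * The cardinals depend only on the length of the interval *)

Section Cardinals.

Variable n : nat.
Notation point := 'I_n.+1.
Implicit Types (a b : point).

(** For uu rooted at one end and dd rooted at the other, the recurrences agree up to reversal of the
    sums. One induction serves all four cases, since cutting an edge leaves one part of each
    kind. *)
Lemma card_avoiders_counts m a b : b = a + m :> nat ->
  [/\ #|avoiders true a a b| = edge_count m, #|avoiders false b a b| = edge_count m,
      #|avoiders true b a b| = chain_count m & #|avoiders false a a b| = chain_count m].
Proof.
elim/ltn_ind: m a b => m IH a b ab.
have [m0|m0] := posnP m.
  have -> : b = a by apply: val_inj => /=; lia.
  by rewrite m0 !card_avoiders_point.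
have ltab : a < b by lia.
have bn := ltn_ord b.
(* Comes first because the recurrences for the chain counts involve the edge count of the whole
   interval. *)
have D1 d : #|edge_avoiders d a b| = edge_count m.
  rewrite card_edge_avoiders // edge_countE // -big_distrl /=; congr (_ * _); last first.
    have -> : (a.+1 == b) = (m == 1) by lia.
    by [].
  case: d; last rewrite (sum_ord_rev m (fun k => edge_count k * chain_count (m.-1 - k))) /=.
    transitivity (\sum_(k : point | a <= k < b)
        edge_count (k - a) * chain_count (m.-1 - (k - a))).
      apply: eq_bigr => k akb.
      have kk' : (inord k.+1 : point) = k.+1 :> nat by rewrite inordK //; lia.
      have [||-> _ _ _] := IH (k - a) _ a k; try lia.
      by have [||_ _ -> _] := IH (m.-1 - (k - a)) _ (inord k.+1) b; try lia.
    rewrite (sum_itv _ (fun k => edge_count (k - a) * chain_count (m.-1 - (k - a))));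
      last by lia.
    rewrite (_ : b - a = m); last by lia.
    by apply: eq_bigr => j _; rewrite addKn.
  transitivity (\sum_(k : point | a <= k < b)
      chain_count (k - a) * edge_count (m.-1 - (k - a))).
    apply: eq_bigr => k akb.
    have kk' : (inord k.+1 : point) = k.+1 :> nat by rewrite inordK //; lia.
    have [||_ _ _ ->] := IH (k - a) _ a k; try lia.
    by have [||_ -> _ _] := IH (m.-1 - (k - a)) _ (inord k.+1) b; try lia.
  rewrite (sum_itv _ (fun k => chain_count (k - a) * edge_count (m.-1 - (k - a))));
      last by lia.
  rewrite (_ : b - a = m); last by lia.
  apply: eq_bigr => j _; rewrite addKn mulnC; congr (_ * chain_count _).
  by have := ltn_ord j; lia.
split; first by rewrite avoiders_edge_up.
- by rewrite avoiders_edge_down.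
- rewrite card_avoiders_up // chain_countE //.
  transitivity (\sum_(c : point | a <= c < b)
      chain_count (c - a) * edge_count (m - (c - a))).
    apply: eq_bigr => c acb.
    have [||_ _ -> _] := IH (c - a) _ a c; try lia.
    have [ca|ca] := eqVneq c a.
      by rewrite ca D1; congr (_ * edge_count _); lia.
    move: ca; rewrite -val_eqE /= => ca.
    rewrite -avoiders_edge_up; last by lia.
    by have [||-> _ _ _] := IH (m - (c - a)) _ c b; try lia.
  rewrite (sum_itv _ (fun c => chain_count (c - a) * edge_count (m - (c - a)))); last by lia.
  rewrite (_ : b - a = m); last by lia.
  by apply: eq_bigr => j _; rewrite addKn.
- rewrite card_avoiders_down // chain_countE //.
  rewrite (sum_ord_rev m (fun j => chain_count j * edge_count (m - j))) /=.
  (* Shifting both bounds gives the half-open range that [sum_itv] expects. *)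
  transitivity (\sum_(c : point | a.+1 <= c < b.+1)
      edge_count (c - a) * chain_count (m - (c - a))).
    apply: eq_big => [c|c acb]; first by lia.
    have [||_ _ _ ->] := IH (m - (c - a)) _ c b; try lia.
    have [cb|cb] := eqVneq c b.
      by rewrite cb D1; congr (edge_count _ * _); lia.
    move: cb; rewrite -val_eqE /= => cb.
    rewrite -avoiders_edge_down; last by lia.
    by have [||_ -> _ _] := IH (c - a) _ a c; try lia.
  rewrite (sum_itv _ (fun c => edge_count (c - a) * chain_count (m - (c - a)))); last by lia.
  rewrite (_ : b.+1 - a.+1 = m); last by lia.
  apply: eq_bigr => j _; rewrite mulnC; have := ltn_ord j => jm.
  by congr (chain_count _ * edge_count _); lia.
Qed.

End Cardinals.

(** * From labelled trees and words to trees with strict gaps *)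

Section Link.

Variable n : nat.
Notation point := 'I_n.+1.
Notation graph := {set {set point}}.
Notation gapset := {set point}.
Notation labelling := {ffun point -> 'I_n.+2}.
Implicit Types (E : graph) (S : gapset) (x y z u v g : point) (l : labelling).

Lemma nctree_full E : nctree ord0 ord_max E = tree E && noncrossing E.
Proof.
rewrite /nctree /tree; congr (_ && _).
have -> : itv ord0 ord_max = [set: point].
  by apply/setP => x; rewrite !inE /= -ltnS ltn_ord.
congr [&& _, _ & _].
- by apply: eq_forallb => e; rewrite subsetT andbT.
- by apply: eq_forallb => x; rewrite inE /=; apply: eq_forallb => y; rewrite inE.
Qed.

(** A simple path visits [y] once, so its part before [y] avoids every edge at [y]. *)
Lemma root_path_par E p1 y p2 :
  root_path E (p1 ++ y :: p2) -> par ord0 E (last ord0 p1) y.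
Proof.
case/andP; rewrite cat_path /= => /and3P[p1E xy _] /= /andP[n0 up].
have n0y : y != ord0 by apply: contraNneq n0 => <-; rewrite mem_cat inE eqxx orbT.
have yp1 : y \notin p1.
  by move: up; rewrite cat_uniq /= negb_or => /and3P[_ /andP[]].
rewrite /par xy; apply/connectP; exists p1 => //.
apply: (@sub_in_path _ (predC1 y) (adj E)) p1E.
  move=> u v; rewrite !inE => uy vy uv; rewrite adjD1 uv andbT eq_set2.
  by rewrite (negPf uy) (negPf vy) !andbF.
apply/allP => v; rewrite inE => /orP[/eqP->|vp1]; first by rewrite /= eq_sym.
by apply: contraNneq yp1 => <-.
Qed.

(** If [z] were already on the path, the initial part up to [z] would miss the end point [y]; then
    [y] and [z] would be joined through the root without their edge, which is a bridge. *)
Lemma root_path_rcons E q z : acyclic E -> root_path E q ->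
  par ord0 E (last ord0 q) z -> root_path E (rcons q z).
Proof.
move=> acE /andP[qE uq] /[dup] pyz /andP[yz cyz].
rewrite /root_path rcons_path qE yz -rcons_cons rcons_uniq uq !andbT /=.
apply/negP => zq; move: qE uq pyz yz cyz.
case/splitPl: zq => q1 q2 lq1; rewrite cat_path lq1 last_cat lq1.
case: q2 => [|w q2] /andP[q1E q2E] uq pyz yz cyz.
  by move: yz; rewrite /= /adj eqxx.
set y := last z (w :: q2) in pyz yz cyz.
have yq2 : y \in w :: q2 by rewrite /y /= mem_last.
have yq1 : y \notin ord0 :: q1.
  by move: uq; rewrite -cat_cons cat_uniq => /and3P[_ /hasPn/(_ y yq2)].
have /negP := acyclic_bridge acE yz; apply.
apply: (@connect_trans _ _ ord0); first by rewrite connectC.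
apply/connectP; exists q1 => //.
apply: (@sub_in_path _ (predC1 y) (adj E)) q1E.
  move=> u v; rewrite !inE => uy vy uv; rewrite adjD1 uv andbT eq_set2.
  by rewrite (negPf uy) (negPf vy) !andbF.
by apply/allP => v vq1; apply: contraNneq yq1 => <-.
Qed.

Lemma root_path_exists E x : connected E ->
  exists2 q, root_path E q & last ord0 q = x.
Proof.
move=> /forallP/(_ ord0)/forallP/(_ x)/connectP[p pE ->].
by case/shortenP: pE => q qE uq _; exists q => //; apply/andP.
Qed.

(** Follow a path from the root to [x]: just before its first use of {x, y} it stands at one end of
    that edge, and if it never uses the edge it reaches [x]. *)
Lemma par_total E x y : connected E -> adj E x y ->
  par ord0 E x y || par ord0 E y x.
Proof.
move=> cE xy; rewrite /par [adj E y x]adjC xy /= [[set y; x]]setUC.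
have /forallP/(_ ord0)/forallP/(_ x)/connectP[p] := cE.
elim: p (ord0 : point) => [|v p IH] u /= => [_ ->|]; first by rewrite connect0.
move=> /andP[uv pv] lx.
case: (boolP ([set u; v] == [set x; y])) => [|ne].
  by rewrite eq_set2 => /orP[]/andP[/eqP-> _]; rewrite connect0 ?orbT.
have uv' : adj (E :\ [set x; y]) u v by rewrite adjD1 ne.
have /orP[] := IH _ pv lx => h; apply/orP; [left|right];
  exact: connect_trans (connect1 uv') h.
Qed.

Lemma infix1_pairmap (f : point -> point -> letter) r p A :
  reflect (exists p1 y p2, p = p1 ++ y :: p2 /\ f (last r p1) y = A)
          (infix [:: A] (pairmap f r p)).
Proof.
apply: (iffP (@infixP _ [:: A] (pairmap f r p))) =>
  [[s1 [s2]]|[p1 [y [p2 [-> <-]]]]]; last first.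
  exists (pairmap f r p1), (pairmap f y p2).
  by rewrite pairmap_cat /=.
elim: s1 r p => [|B s1 IH] r [|y p] //= [].
  by move=> <- _; exists [::], y, p.
by move=> _ /IH[p1 [z [p2 [-> <-]]]]; exists (y :: p1), z, p2.
Qed.

Lemma infix2_pairmap (f : point -> point -> letter) r p A B :
  reflect (exists p1 y z p2,
             [/\ p = p1 ++ [:: y, z & p2], f (last r p1) y = A & f y z = B])
          (infix [:: A; B] (pairmap f r p)).
Proof.
apply: (iffP (@infixP _ [:: A; B] (pairmap f r p))) =>
  [[s1 [s2]]|[p1 [y [z [p2 [-> <- <-]]]]]]; last first.
  exists (pairmap f r p1), (pairmap f z p2).
  by rewrite pairmap_cat /=.
elim: s1 r p => [|C s1 IH] r [|y p] //=.
  by case: p => [|z p] //= [<- <- _]; exists [::], y, z, p.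
by case=> _ /IH[p1 [w [z [p2 [-> <- <-]]]]]; exists (y :: p1), w, z, p2.
Qed.

Lemma contains1P E l A : tree E ->
  reflect (exists x y, par ord0 E x y /\ step l x y = A) (contains (E, l) [:: A]).
Proof.
move=> /and3P[_ cE acE]; apply: (iffP (containsP _ _)) => /=.
  case=> p rp /infix1_pairmap[p1 [y [p2 [pE st]]]].
  by exists (last ord0 p1), y; split=> //; apply: root_path_par (p2) _; rewrite -pE.
case=> x [y [xy st]]; have [q rq lq] := root_path_exists x cE.
exists (rcons q y); first by apply: root_path_rcons; rewrite ?lq.
by apply/infix1_pairmap; exists q, y, [::]; rewrite -cats1 lq.
Qed.

Lemma contains2P E l A B : tree E ->
  reflect (exists x y z, [/\ par ord0 E x y, par ord0 E y z,
                             step l x y = A & step l y z = B])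
          (contains (E, l) [:: A; B]).
Proof.
move=> /and3P[_ cE acE]; apply: (iffP (containsP _ _)) => /=.
  case=> p rp /infix2_pairmap[p1 [y [z [p2 [pE st1 st2]]]]].
  exists (last ord0 p1), y, z; split=> //.
    by apply: root_path_par (z :: p2) _; rewrite -pE.
  have := @root_path_par E (rcons p1 y) z p2; rewrite last_rcons; apply.
  by rewrite cat_rcons -pE.
case=> x [y [z [xy yz st1 st2]]]; have [q rq lq] := root_path_exists x cE.
exists (rcons (rcons q y) z).
  by apply: root_path_rcons; rewrite ?last_rcons //; apply: root_path_rcons; rewrite ?lq.
by apply/infix2_pairmap; exists q, y, z, [::]; rewrite -!cats1 -catA lq.
Qed.

(** The label of a point will be one more than this number of strict gaps before it. The index is a
    natural number so that inductions can run along the points. *)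
Definition below S (i : nat) := #|[set g in S | g < i]|.

Lemma below0 S : below S 0 = 0.
Proof. by apply/eqP; rewrite cards_eq0; apply/eqP/setP => g; rewrite !inE andbF. Qed.

Lemma belowS S g : below S g.+1 = below S g + (g \in S).
Proof.
rewrite /below (cardsD1 g) !inE ltnSn andbT addnC; congr (_ + _).
apply: eq_card => h; rewrite !inE ltnS leq_eqVlt -[h == g]val_eqE /=.
by case: (h \in S); lia.
Qed.

Lemma below_step S (i : nat) : i <= n -> below S i <= below S i.+1 <= (below S i).+1.
Proof.
move=> lein; have iE : (inord i : point) = i :> nat by rewrite inordK.
by rewrite -iE belowS iE; case: (_ \in S); lia.
Qed.

Lemma below_le S (i : nat) : i <= n -> below S i <= i.
Proof.
elim: i => [|i IH] lein; first by rewrite below0.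
by have := below_step S (ltnW lein); have := IH (ltnW lein); lia.
Qed.

Lemma below_mono S (i j : nat) : i <= j -> below S i <= below S j.
Proof.
move=> ij; apply: subset_leq_card; apply/subsetP => g; rewrite !inE.
by case: (g \in S) => //=; lia.
Qed.

Lemma below_lt S x y : x < y ->
  (below S x < below S y) = [exists g in S, x <= g < y].
Proof.
move=> xy; apply/idP/existsP => [lt|[g /andP[gS gxy]]].
  apply/existsP; apply: contraLR lt; rewrite negb_exists -leqNgt => /forallP no.
  apply: subset_leq_card; apply/subsetP => g; rewrite !inE => /andP[gS gy].
  by have := no g; rewrite gS; lia.
apply: proper_card; apply/properP; split.
  by apply/subsetP => h; rewrite !inE; case: (h \in S) => //=; lia.
by exists g; rewrite !inE gS /=; lia.
Qed.

Definition lab S : labelling := [ffun x : point => inord (below S x).+1].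

Lemma labE S x : lab S x = (below S x).+1 :> nat.
Proof.
rewrite ffunE inordK // !ltnS; apply: leq_trans (below_le _ _) _;
  by have := ltn_ord x; lia.
Qed.

(** The test [g < n] discards the last point, for which [inord] would return a default. *)
Definition gaps_of l : gapset :=
  [set g : point | (g < n) && (l g < l (inord g.+1))].

(** Every value up to the label of the last point is taken because consecutive labels differ by at
    most one: a discrete intermediate value argument. *)
Lemma lab_GNC S : GNC_labelling (lab S).
Proof.
apply/and3P; split; first by rewrite labE below0.
  apply/forallP => x; apply/forallP => y; apply/implyP => xy.
  by rewrite !labE ltnS below_mono.
apply/existsP; exists (lab S ord_max); apply/forallP => k; apply/eqP.
apply/codomP/idP => [[x ->]|].
  rewrite !labE /= ltnS below_mono //.
  by have := ltn_ord x; rewrite ltnS.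
rewrite labE /= => /andP[k0 kn].
suff h (i : nat) : i <= n -> k <= (below S i).+1 -> exists x, k = lab S x.
  by apply: (h n).
elim: i => [|i IH] lein ki.
  by exists ord0; apply: val_inj; rewrite /= labE /=; move: ki; rewrite below0; lia.
have := below_step S (ltnW lein).
have [kle|klt] := leqP k (below S i).+1; first by move=> _; apply: IH => //; lia.
move=> bs; exists (Ordinal (lein : i.+1 < n.+1)).
by apply: val_inj; rewrite /= labE /=; lia.
Qed.

Lemma gaps_of_lab S : S \subset gaps ord0 ord_max -> gaps_of (lab S) = S.
Proof.
move=> /subsetP Sg; apply/setP => g; rewrite inE.
case: (boolP (g \in S)) => gS.
  have := Sg g gS; rewrite inE /= => gn; rewrite gn /= !labE inordK //.
  by rewrite belowS gS; lia.
apply/negP => /andP[gn]; rewrite !labE inordK //.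
by rewrite belowS (negPf gS); lia.
Qed.

(** A labelling is recovered from its strict gaps because it starts at 1 and goes up by at most one
    at a time. *)
Lemma lab_gaps_of l : GNC_labelling l -> lab (gaps_of l) = l.
Proof.
case/and3P=> /eqP l0 /forallP mono /existsP[m /forallP lm].
have {}mono x y : x <= y -> l x <= l y.
  by move=> xy; have /forallP/(_ y)/implyP/(_ xy) := mono x.
suff h (i : nat) : i <= n -> (below (gaps_of l) i).+1 = l (inord i).
  apply/ffunP => x; apply: val_inj; rewrite /= labE h ?inord_val //.
  by have := ltn_ord x; rewrite ltnS.
elim: i => [|i IH] lein.
  by rewrite below0 -l0; congr (nat_of_ord (l _)); apply: val_inj; rewrite /= inordK.
have iE : (inord i : point) = i :> nat by rewrite inordK //; lia.
have i1E : (inord i.+1 : point) = i.+1 :> nat by rewrite inordK.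
have IHi := IH (ltnW lein).
rewrite -{1}iE belowS inE iE lein /= -addSn IHi {IH IHi}.
have le1 : l (inord i) <= l (inord i.+1) by apply: mono; lia.
(* A larger increase would skip a value that has to be taken, and monotonicity leaves no place for
   it. *)
have le2 : l (inord i.+1) <= (l (inord i)).+1.
  rewrite leqNgt; apply/negP => gap.
  have vlt : (l (inord i)).+1 < n.+2 by apply: leq_ltn_trans (ltnW gap) (ltn_ord _).
  have := lm (l (inord i.+1)); rewrite codom_f => /eqP/esym/andP[_ lem].
  have := lm (Ordinal vlt) => /eqP /= vm.
  have : Ordinal vlt \in codom l by rewrite vm; lia.
  case/codomP=> j /(congr1 val) /= vj.
  have [ji|ij] := leqP j i.
    have lj : l j <= l (inord i) by apply: mono; lia.
    by lia.
  have lj : l (inord i.+1) <= l j by apply: mono; lia.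
  by lia.
by case: ltnP => /=; lia.
Qed.

Lemma strict_labP E S :
  reflect (forall x y, adj E x y -> lab S x != lab S y) (strict E S).
Proof.
apply: (iffP forallP) => [st x y xy|h x].
  wlog lxy : x y xy / x < y.
    move=> th; case: (ltngtP x y) => [|yx|/val_inj e]; first exact: th.
      by rewrite eq_sym; apply: th; rewrite // adjC.
    by move: xy; rewrite e /adj eqxx.
  have /forallP/(_ y) := st x; rewrite xy lxy -below_lt // => lt.
  by rewrite -val_eqE /= !labE; lia.
apply/forallP => y; apply/implyP => /andP[xy lxy]; rewrite -below_lt //.
have := h x y xy; rewrite -val_eqE /= !labE eqSS.
by have := below_mono S (ltnW lxy); lia.
Qed.

Lemma step_lab S x y : lab S x != lab S y ->
  step (lab S) x y = if x < y then Ascent else Descent.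
Proof.
move=> ne; rewrite /step (negPf ne).
move: ne; rewrite -val_eqE /= !labE eqSS ltnS => ne.
case: (leqP y x) => yx; first by rewrite ifF //; have := below_mono S yx; lia.
by rewrite ifT //; have := below_mono S (ltnW yx); lia.
Qed.

Lemma card_GNC_avoid (d : bool) :
  let A := if d then Ascent else Descent in
  #|GNC_avoid n [:: [:: A; A]; [:: Level]]| = #|avoiders d ord0 (ord0 : point) ord_max|.
Proof.
move=> A.
have key E S : tree E ->
    ~~ contains (E, lab S) [:: A; A] && ~~ contains (E, lab S) [:: Level] =
    avoid d ord0 E && strict E S.
  move=> tE; have /and3P[_ cE acE] := tE.
  have -> : ~~ contains (E, lab S) [:: Level] = strict E S.
    apply/idP/strict_labP => [/(contains1P _ _ tE) no x y xy|st].
      apply/negP => /eqP eqxy; apply: no.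
      have /orP[pxy|pyx] := par_total cE xy.
        by exists x, y; rewrite /step eqxy ltnn eqxx.
      by exists y, x; rewrite /step eqxy ltnn eqxx.
    apply/(contains1P _ _ tE) => -[x [y [/andP[xy _]]]]; rewrite step_lab ?st //.
    by case: ifP.
  rewrite andbC [RHS]andbC; case: strict_labP => //= st.
  have stepA x y : adj E x y -> step (lab S) x y = A <-> ltd d x y.
    move=> xy; rewrite step_lab ?st // /A /ltd.
    have : x != y by case/andP: xy.
    by rewrite -val_eqE /=; case: (d); case: ltngtP.
  apply/idP/avoidP => [/(contains2P _ _ _ tE) no x y z pxy pyz lxy lyz|av].
    apply: no; exists x, y, z; split=> //; apply/stepA => //.
      by case/andP: pxy.
    by case/andP: pyz.
  apply/(contains2P _ _ _ tE) => -[x [y [z [pxy pyz]]]].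
  have [xy _] := andP pxy; have [yz _] := andP pyz.
  by move=> /(stepA _ _ xy) + /(stepA _ _ yz); apply: av pxy pyz.
apply: (@card_in_bij _ _ _ _ (fun t => (t.1, gaps_of t.2)) (fun t => (t.1, lab t.2))).
- move=> [E l]; rewrite !inE /= andbT => /andP[/and3P[tE nE lE]].
  rewrite -(lab_gaps_of lE) key // => /andP[av st].
  rewrite /avoider /= nctree_full tE nE av (lab_gaps_of lE) st !andbT /=.
  by apply/subsetP => g; rewrite !inE /= => /andP[].
- move=> [E S]; rewrite !inE /= andbT => /and4P[/=].
  rewrite nctree_full => /andP[tE nE] av gS st.
  by rewrite tE nE lab_GNC /= key // av.
- by move=> [E l]; rewrite !inE /= => /andP[/and3P[_ _ lE] _]; rewrite lab_gaps_of.
- by move=> [E S]; rewrite !inE /= => /and4P[_ _ /= gS _]; rewrite gaps_of_lab.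
Qed.

Lemma card_uu_h :
  #|GNC_avoid n [:: [:: Ascent; Ascent]; [:: Level]]| = edge_count n.
Proof.
rewrite (card_GNC_avoid true).
by have [-> _ _ _] := @card_avoiders_counts n n ord0 ord_max erefl.
Qed.

Lemma card_dd_h :
  #|GNC_avoid n [:: [:: Descent; Descent]; [:: Level]]| = chain_count n.
Proof.
rewrite (card_GNC_avoid false).
by have [_ _ _ ->] := @card_avoiders_counts n n ord0 ord_max erefl.
Qed.

End Link.

(** * Generating functions *)

Import Order.TTheory GRing.Theory Num.Theory.
Local Open Scope ring_scope.

Lemma central_binS k :
  'C(2 * k.+1, k.+1)%:R * k.+1%:R = 2%:R * (2 * k + 1)%:R * 'C(2 * k, k)%:R :> rat.
Proof.
have h m : 'C(2 * m, m)%:R * (m`!%:R * m`!%:R) = (2 * m)`!%:R :> rat.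
  by rewrite -!natrM -[in RHS](bin_fact (leq_pmull m (isT : (0 < 2)%N))) mul2n -addnn addnK.
have fn0 m : m`!%:R != 0 :> rat by rewrite pnatr_eq0 -lt0n fact_gt0.
have S0 : k.+1%:R != 0 :> rat by rewrite pnatr_eq0.
apply: (mulIf (mulf_neq0 S0 (mulf_neq0 (fn0 k) (fn0 k)))).
have := h k.+1; rewrite factS (_ : (2 * k.+1 = (2 * k).+2)%N); last by lia.
rewrite 2!factS !natrM -(h k) => e.
transitivity ('C((2 * k).+2, k.+1)%:R * (k.+1%:R * k`!%:R * (k.+1%:R * k`!%:R)) : rat).
  by ring.
rewrite e (_ : (2 * k).+2 = (2 * k.+1)%N); last by lia.
by rewrite addn1 natrM; ring.
Qed.

(* The summand telescopes: it is the difference of the [g] below, given by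
   Gosper's algorithm. *)
Lemma Catalan_Segner n :
  \sum_(i < n.+1) Catalan i * Catalan (n - i) = Catalan n.+1.
Proof.
pose B k : rat := 'C(2 * k, k)%:R.
pose g j : rat := B j * B (n.+1 - j)%N * (j%:R *+ 2 - n.+1%:R)
                  / (2%:R * n.+1%:R * n.+2%:R).
have step i : (i < n.+1)%N -> Catalan i * Catalan (n - i) = g i.+1 - g i.
  move=> lti; have [l defn] : exists l, n = (i + l)%N by exists (n - i)%N; lia.
  rewrite /g defn (_ : (i + l - i = l)%N) ?addKn //.
  rewrite (_ : ((i + l).+1 - i.+1 = l)%N); last by lia.
  rewrite (_ : ((i + l).+1 - i = l.+1)%N); last by lia.
  have Si0 k : k.+1%:R != 0 :> rat by rewrite pnatr_eq0.
  have BS k : B k.+1 = 2%:R * (2%:R * k%:R + 1) * B k / k.+1%:R.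
    by rewrite /B -natrM natr1 -[(2 * k).+1]addn1 -central_binS mulfK.
  rewrite /Catalan -/(B i) -/(B l) !BS.
  have := Si0 i; have := Si0 l; have := Si0 (i + l)%N; have := Si0 (i + l).+1.
  rewrite -![_.+1%:R]natr1 natrD => h1 h2 h3 h4.
  field.
  by rewrite h1 h2 h3 h4.
rewrite -(big_mkord xpredT (fun i => Catalan i * Catalan (n - i))).
rewrite (eq_big_nat _ _ (F2 := fun i => g i.+1 - g i)); last by move=> i; apply: step.
rewrite telescope_sumr // /g subnn subn0 /B /Catalan muln0 !bin0.
by field; rewrite !lt0r_neq0 // ltr_pwDl ?ler0n.
Qed.

(** * Quadratic equations modulo a power of the indeterminate *)

Section Truncation.

Variable N : nat.
Implicit Types (p q r F G t w : {poly rat}).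

(** Power series are replaced by polynomials modulo ['X^N], with [N] beyond the coefficient of
    interest. *)
Definition eqm p q := 'X^N %| p - q.

Lemma eqmP p q : reflect (forall i, (i < N)%N -> p`_i = q`_i) (eqm p q).
Proof.
apply: (iffP idP) => [/dvdpP[r pq] i iN|pq].
  by apply/eqP; rewrite -subr_eq0 -coefB pq coefMXn iN.
rewrite /eqm -[p - q](poly_take_drop N) dvdp_add ?dvdp_mull //.
suff -> : take_poly N (p - q) = 0 by rewrite dvdp0.
apply/polyP => i; rewrite coef_take_poly coef0; case: ifP => // iN.
by rewrite coefB pq ?subrr.
Qed.

(** The difference of the two equations is [F - G] times [1 - 'X * w * (F + G)], which has constant
    term 1 and is thus coprime to ['X^N]. *)
Lemma eqm_quadratic_uniq t w F G :
    eqm F (t + 'X * w * F ^+ 2) -> eqm G (t + 'X * w * G ^+ 2) ->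
  eqm F G.
Proof.
rewrite /eqm => hF hG.
have cop : coprimep 'X^N (1 - 'X * w * (F + G)).
  apply: coprimep_expl; rewrite coprimep_sym coprimepX.
  by rewrite /root hornerD hornerN -mulrA hornerM hornerX mul0r subr0 hornerC oner_neq0.
rewrite -(Gauss_dvdpr _ cop).
suff -> : (1 - 'X * w * (F + G)) * (F - G) =
    (F - (t + 'X * w * F ^+ 2)) - (G - (t + 'X * w * G ^+ 2)) by rewrite dvdp_sub.
by ring.
Qed.

Definition catalan_poly := \poly_(i < N) Catalan i.

Lemma catalan_polyE : eqm catalan_poly (1 + 'X * catalan_poly ^+ 2).
Proof.
apply/eqmP => -[|i] iN; rewrite coefD coefXM coef1 coef_poly iN /=.
  by rewrite addr0 /Catalan muln0 bin0 invr1 mul1r.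
rewrite add0r expr2 coefM -Catalan_Segner; apply: eq_bigr => j _.
by rewrite !coef_poly !ifT //; have := ltn_ord j; lia.
Qed.

(** Substituting [z] for the indeterminate in [catalan_poly] and multiplying by [t] gives a solution
    of the same equation; uniqueness concludes. *)
Lemma eqm_quadratic t w F : eqm F (t + 'X * w * F ^+ 2) ->
  eqm F (\sum_(i < N) (Catalan i)%:P * ('X * w * t) ^+ i * t).
Proof.
move=> hF; set z := 'X * w * t.
have -> : \sum_(i < N) (Catalan i)%:P * z ^+ i * t = t * (catalan_poly \Po z).
  rewrite /catalan_poly poly_def raddf_sum mulr_sumr; apply: eq_bigr => i _.
  by rewrite /= comp_polyZ comp_Xn_poly mulrC mul_polyC.
apply: eqm_quadratic_uniq hF _.
have /dvdpP[r] := catalan_polyE; rewrite -/catalan_poly.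
move/eqP; rewrite subr_eq => /eqP hP.
have := congr1 (fun p => p \Po z) hP.
rewrite !(comp_polyD, comp_polyM, comp_Xn_poly, comp_polyX, rmorphXn, comp_polyC) /=.
set Pz := catalan_poly \Po z => hz.
rewrite /eqm.
have -> : t * Pz - (t + 'X * w * (t * Pz) ^+ 2) = t * (Pz - (1 + z * Pz ^+ 2)).
  by rewrite /z; ring.
rewrite {1}hz rmorph1 addrK dvdp_mull // dvdp_mull //.
by rewrite dvdp_exp2r // /z -mulrA dvdp_mulr.
Qed.

Variable q : rat.

(** The truncated negative binomial series of [1 / (1 - q X) ^ (i + 1)]. *)
Definition negbin (i : nat) := \poly_(m < N) ('C(m + i, m)%:R * q ^+ m).

Lemma negbin0 : eqm ((1 - q%:P * 'X) * negbin 0) 1.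
Proof.
apply/eqmP => -[|i] iN; rewrite mulrBl mul1r coefB -mulrA coefCM coefXM coef1.
  by rewrite coef_poly iN /= bin0 !mulr1 mulr0 subr0.
by rewrite /= !coef_poly iN (ltnW iN) !addn0 !binn !mul1r exprS subrr.
Qed.

Lemma negbinS i : eqm ((1 - q%:P * 'X) * negbin i.+1) (negbin i).
Proof.
apply/eqmP => -[|m] mN; rewrite mulrBl mul1r coefB -mulrA coefCM coefXM.
  by rewrite !coef_poly mN /= !bin0 !mulr1 mulr0 subr0.
rewrite /= !coef_poly mN (ltnW mN).
rewrite (_ : (m.+1 + i.+1 = (m + i).+1.+1)%N); last by lia.
rewrite (_ : (m.+1 + i = (m + i).+1)%N) // (_ : (m + i.+1 = (m + i).+1)%N); last by lia.
by rewrite binS natrD exprS; ring.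
Qed.

Lemma negbin_exp i : eqm (negbin 0 ^+ i.+1) (negbin i).
Proof.
elim: i => [|i IH]; first by rewrite expr1 /eqm subrr dvdp0.
have h0 := negbin0; have hS := negbinS i; move: h0 hS IH.
rewrite /eqm => h0 hS IH; rewrite exprS.
set u := negbin 0 in h0 hS IH *; set v := negbin i in hS IH *.
set v' := negbin i.+1 in hS *; set U := u ^+ i.+1 in IH *.
have -> : u * U - v' = u * (U - v) - u * ((1 - q%:P * 'X) * v' - v)
                       + v' * ((1 - q%:P * 'X) * u - 1) by ring.
by rewrite dvdp_add ?dvdp_sub // dvdp_mull.
Qed.

End Truncation.

(** * The equations for the two counting series *)

Section GeneratingFunctions.

Variable N : nat.

Definition edge_poly : {poly rat} := \poly_(i < N) (edge_count i)%:R.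
Definition chain_poly : {poly rat} := \poly_(i < N) (chain_count i)%:R.

Lemma coef_edge_chain m : (m < N)%N ->
  (edge_poly * chain_poly)`_m =
  (\sum_(k < m.+1) edge_count k * chain_count (m - k))%:R.
Proof.
move=> mN; rewrite coefM natr_sum; apply: eq_bigr => k _.
by rewrite !coef_poly !ifT ?natrM //; have := ltn_ord k; lia.
Qed.

(** The summand [- 'X] makes up for the factor 2 missing from the recurrence at index 1. *)
Lemma edge_polyE :
  eqm N edge_poly (1 - 'X + 2%:R * 'X * (edge_poly * chain_poly)).
Proof.
apply/eqmP => m mN; rewrite coef_poly mN !(coefD, coefN) -mulrA mulr_natl coefMn.
rewrite coefXM coef1 coefX.
case: m mN => [|m] mN; first by rewrite edge_count0 /= mul0rn subr0 addr0.
rewrite /= edge_countE // coef_edge_chain ?(ltnW mN) //=.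
case: m mN => [|m] mN; last by rewrite mulrnA /= !subr0 add0r.
by rewrite big_ord1 edge_count0 chain_count0 /=; ring.
Qed.

(** The recurrence for [chain_count] lacks the term of the Cauchy product whose edge factor has
    index 0. That term is a second copy of [chain_count], whence the factor 2; the 1 corrects index
    0. *)
Lemma chain_polyE : eqm N (edge_poly * chain_poly) (2%:R * chain_poly - 1).
Proof.
apply/eqmP => m mN; rewrite coef_edge_chain // coefB coef1 mulr_natl coefMn coef_poly mN.
case: m mN => [|m] mN; first by rewrite big_ord1 edge_count0 chain_count0 mulr2n addrK.
rewrite /= subr0 mulr2n -natrD; congr _%:R.
rewrite big_ord_recl edge_count0 mul1n subn0; congr addn.
rewrite chain_countE // (sum_ord_rev m.+1 (fun j => chain_count j * edge_count (m.+1 - j))%N).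
apply: eq_bigr => j _; rewrite mulnC; have := ltn_ord j => jm.
by congr (chain_count _ * edge_count _)%N; rewrite /= ?/bump /=; lia.
Qed.

Lemma eqm_chain_coef (q w : rat) (d k m : nat) : (k <= m < N)%N ->
  ((Catalan k)%:P * ('X * w%:P) ^+ k * negbin N q 0 ^+ d.+1)`_m =
  Catalan k * w ^+ k * 'C(m - k + d, m - k)%:R * q ^+ (m - k).
Proof.
move=> kmN; move: (Catalan k) => c; rewrite exprMn -!mulrA coefCM; congr (_ * _).
rewrite coefXnM ltnNge (proj1 (andP kmN)) /= -polyC_exp coefCM; congr (_ * _).
have /eqmP -> := negbin_exp N q d; last by lia.
by rewrite coef_poly ifT //; lia.
Qed.

End GeneratingFunctions.

Lemma edge_count_closed n :
  (edge_count n.+2)%:R =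
    \sum_(0 <= i < n.+1) 'C(n, i)%:R * 2%:R ^+ (i + 2) * Catalan i.+1 :> rat.
Proof.
pose N := n.+2.
have hX := edge_polyE N; have hY := chain_polyE N; have hu := negbin0 N 1.
set X := edge_poly N in hX hY; set Y := chain_poly N in hX hY.
set u := negbin N 1 0 in hu.
have hV : eqm N (X * Y) (1 + 'X * (2%:R * u) * (X * Y) ^+ 2).
  move: hX hY hu; rewrite /eqm polyC1 mul1r => hX hY hu.
  set e1 := X - _ in hX; set e2 := X * Y - _ in hY; set e3 := _ * u - 1 in hu.
  (* Elimination as a polynomial identity: the defect of the equation for [X * Y] is a combination
     of the known defects [e1], [e2] and [e3]. *)
  have -> : X * Y - (1 + 'X * (2%:R * u) * (X * Y) ^+ 2) =
     u * (2%:R * e1 * Y + (- (1 - 'X) - 2%:R * 'X * (X * Y)) * e2)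
     + e3 * (1 - X * Y).
    by rewrite /e1 /e2 /e3; ring.
  apply: dvdp_add; last by apply: dvdp_mulr.
  apply/dvdp_mull/dvdp_add; last by apply: dvdp_mull.
  by rewrite dvdp_mulr // dvdp_mull.
have /eqmP/(_ n.+1 (ltnSn _)) := eqm_quadratic hV.
rewrite coef_edge_chain // coef_sum => VE.
(* The count is twice the coefficient of index [n.+1] in [X * Y]. The Catalan term of index 0 is
   constant and drops out, which shifts the index by one. *)
rewrite edge_countE // natrM mulrC VE mulr_sumr -/N.
rewrite big_ord_recl expr0 !mulr1 coefC /= mulr0 add0r big_mkord.
apply: eq_bigr => i _; rewrite /= /bump /= add1n mulr1.
have -> : 'X * (2%:R * u) = ('X * 2%:R%:P) * u by rewrite -polyC_natr mulrA.
rewrite exprMn mulrA eqm_chain_coef; last by have := ltn_ord i; rewrite /N; lia.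
rewrite expr1n mulr1 subSS subnK -1?ltnS // bin_sub -1?ltnS // !addn2 !exprS.
by ring.
Qed.

Lemma chain_count_closed n :
  (chain_count n)%:R =
    \sum_(0 <= j < n.+1)
        (-1) ^+ j * 'C(2 * n - j, j)%:R * 3%:R ^+ j * 4%:R ^+ (n - j)
        * Catalan (n - j) :> rat.
Proof.
pose N := n.+1.
have hX := edge_polyE N; have hY := chain_polyE N; have hu := negbin0 N (- 3%:R).
set X := edge_poly N in hX hY; set Y := chain_poly N in hX hY.
set u := negbin N (- 3%:R) 0 in hu.
(* Replacing [X * Y] by [2 Y - 1] in the equation for [X] leaves [(1 + 3 'X) Y = 1 + 4 'X Y^2], and
   [u] inverts [1 + 3 'X]. *)
have hF : eqm N Y (u + 'X * (4%:R * u) * Y ^+ 2).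
  move: hX hY hu; rewrite /eqm polyCN -polyC_natr => hX hY hu.
  set e1 := X - _ in hX; set e2 := X * Y - _ in hY; set e3 := _ * u - 1 in hu.
  have -> : Y - (u + 'X * (4%:R * u) * Y ^+ 2) =
     u * (e1 * Y - (1 - 2%:R * 'X * Y) * e2) - e3 * Y.
    by rewrite /e1 /e2 /e3; ring.
  apply: dvdp_sub; last by apply: dvdp_mulr.
  by apply/dvdp_mull/dvdp_sub; [apply: dvdp_mulr|apply: dvdp_mull].
have /eqmP/(_ n (ltnSn _)) := eqm_quadratic hF.
rewrite coef_poly ltnSn coef_sum => ->.
(* For Catalan index [i] the exponent of [-3] is [n - i], so the sum is reversed with
   [j = n - i]. *)
rewrite big_mkord [RHS](reindex_inj rev_ord_inj) /= -/N.
apply: eq_bigr => i _; have ilt := ltn_ord i.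
(* Here the factor [t] is [u] too, so the term of index [i] carries [u] to the power [2 i + 1]; this
   is the source of the upper index [n + i] of the binomial. *)
have -> : 'X * (4%:R * u) * u = ('X * 4%:R%:P) * u ^+ 2.
  by rewrite -polyC_natr; ring.
rewrite exprMn -exprM mulrA -[_ * _ * u]mulrA -exprSr eqm_chain_coef; last by lia.
rewrite subSS subKn; last by lia.
rewrite (_ : (n - i + 2 * i = n + i)%N); last by lia.
rewrite (_ : (2 * n - (n - i) = n + i)%N); last by lia.
rewrite -mulN1r exprMn; ring.
Qed.

Theorem theorem3p2 (n : nat) :
  #|GNC_avoid n.+2 [:: [:: Ascent; Ascent]; [:: Level]]|%:R
    = \sum_(0 <= i < n.+1) 'C(n, i)%:R * 2%:R ^+ (i + 2) * Catalan i.+1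
  /\
  #|GNC_avoid n [:: [:: Descent; Descent]; [:: Level]]|%:R
    = \sum_(0 <= j < n.+1)
        (-1) ^+ j * 'C(2 * n - j, j)%:R * 3%:R ^+ j * 4%:R ^+ (n - j)
        * Catalan (n - j).
Proof.
by rewrite card_uu_h card_dd_h; split; [exact: edge_count_closed|exact: chain_count_closed].
Qed.
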